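(* Let $F_n$ be a free group of finite rank $n$ and let $H$ be an echelon subgroup of $F_n$. Then $H$ is inert in $F_n$, i.e. $\mathrm{rk}(H \cap G) \leq \mathrm{rk}(G)$ for every subgroup $G$ of $F_n$.
   Context: $\mathrm{rk}$ denotes the rank of a free group (the cardinality of a free basis); the trivial group has rank $0$. Subgroups need not be proper. Let $X = \{x_1, \ldots, x_n\}$ be an ordered free basis of $F_n$, and let $F_i = \langle x_1, \ldots, x_i \rangle$ for $i = 0, \ldots, n$, with $F_0 = \langle 1 \rangle$ the trivial subgroup. A subgroup $H$ of $F_n$ is in echelon form with respect to $X$ if $\mathrm{rk}(H \cap F_i) - \mathrm{rk}(H \cap F_{i-1}) \leq 1$ for each $i = 1, \ldots, n$. A subgroup $H$ of $F_n$ is an echelon subgroup of $F_n$ if it is in echelon form with respect to some ordered free basis of $F_n$. *)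

(* Defs.v *)
From mathcomp Require Import all_boot.
From mathcomp Require Import all_classical.

Set Implicit Arguments.
Unset Strict Implicit.
Unset Printing Implicit Defensive.

Local Open Scope classical_set_scope.
Local Open Scope card_scope.
Local Open Scope group_scope.

Section FreeGroups.
Variable F : groupType.
Implicit Types (H K B : set F) (w : seq (F * bool)).

Definition subgroup H : Prop := group_closed (mem H).

Definition generated (S : set F) : set F := smallest subgroup S.

(* A word over B^{+-1}: the letter (b, false) stands for b and (b, true) for
   b^-1. *)
Definition word_over B w : Prop := forall l, l \in w -> B l.1.

Definition reduced w : bool :=
  sorted (fun k l => ~~ ((k.1 == l.1) && (k.2 != l.2))) w.

Definition word_val w : F := \prod_(l <- w) (if l.2 then l.1^-1 else l.1).

Definition free_basis H B : Prop :=
  generated B = H /\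
  forall w, word_over B w -> reduced w -> w != [::] -> word_val w != 1.

(* The rank is a cardinal; it is represented by a chosen free basis, and such
   representatives are compared by #<= only.  In a free group F every subgroup
   has a free basis, and any two have the same cardinality, so neither the
   default value set0 nor the choice matters. *)
Definition rk H : set F := xget set0 [set B | free_basis H B].

Definition card_succ (A : set F) : set (option F) :=
  [set None] `|` (Some @` A).

Definition ordered_free_basis n (x : n.-tuple F) : Prop :=
  uniq x /\ free_basis [set: F] [set` x].

Definition free_of_rank n : Prop := exists x : n.-tuple F, ordered_free_basis x.

(* The subgroup F_i generated by x_1, ..., x_i. *)
Definition flag n (x : n.-tuple F) (i : nat) : set F :=
  generated [set` take i x].

(* rk (H :&: F_i) - rk (H :&: F_(i-1)) <= 1 is written additively, which makes
   sense for arbitrary cardinals. *)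
Definition echelon_form n (x : n.-tuple F) H : Prop :=
  forall i : nat, (1 <= i <= n)%N ->
    rk (H `&` flag x i) #<= card_succ (rk (H `&` flag x i.-1)).

Definition echelon_subgroup n H : Prop :=
  subgroup H /\
  exists x : n.-tuple F, ordered_free_basis x /\ echelon_form x H.

Definition inert H : Prop :=
  forall G : set F, subgroup G -> rk (H `&` G) #<= rk G.

End FreeGroups.

(* Main.v *)
(* Let X be the ordered basis, K = H cap G.  Since H cap F_(i-1) is a free factor
   of H cap F_i, the rank conditions give generators h_1, ..., h_r of H whose
   largest basis letters are pairwise distinct.  Order the edges (f, x) of the
   Cayley tree T of F first by the letter x and then by a left order of F at f.
   The largest edge on the path from f to f h_i determines (f, i) because its
   letter determines i; pulling the order back along this map gives an
   F-invariant order on the graph T_H with edges (f, h_i).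

   Following Mineyev and Dicks, call an edge of (a G-invariant part of) an
   ordered tree essential if, among the smaller edges, both of its sides are
   infinite.  In a finite graph covered by the tree the essential edges satisfy
   #ess >= #E - #V (each other edge cuts off a finite cluster, and different
   orbits of clusters can be given different orbits of roots) and, if there are
   any, #ess <= #E - #V (deleting them leaves no finite component).  A side in
   T_H is contained in the corresponding side in T, so essential edges of T_H
   modulo K inject into those of T modulo G, whence
   rk K - 1 <= #ess (T_H / K) <= #ess (T / G) <= rk G - 1. *)

From Stdlib Require Import ZArith Lia.
Require Import Defs.
From mathcomp Require Import all_boot.
From mathcomp Require Import all_classical.

Set Implicit Arguments.
Unset Strict Implicit.
Unset Printing Implicit Defensive.

Local Open Scope classical_set_scope.
Local Open Scope group_scope.

(** * Words and free reduction *)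

Section Words.
Variable F : groupType.
Implicit Types (H K B S : set F) (w : seq (F * bool)) (l k : F * bool).

(** The intersection K is not known to be finitely generated, and the quotient graphs are infinite
    in general. Hence a finite part [bs] of a basis of K is fixed and everything is counted in
    finite subgraphs: words for [bs] over the h_i span a finite graph modulo K, and the paths of
    these h_i span its finite image modulo G. The bound on [size bs] does not depend on [bs], so
    finiteness of rk K comes out as a consequence. Ranks are tied to edge and vertex counts through
    Z/2-valued cochains: an injection between function spaces stands in for Euler characteristics
    and covering theory. In the edge order the letter comes first so that distinct largest letters
    let a leading edge identify its generator. The left order only separates edges with the same
    letter; its invariance under F makes being essential a property of orbits. Two cases escape the
    chain of inequalities. If the image has no essential edge, only rk K <= 1 follows and trivial G
    is treated apart; if rk G is infinite, countability of F suffices. *)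

Definition letter_val l : F := if l.2 then l.1^-1 else l.1.

Definition letter_inv l : F * bool := (l.1, ~~ l.2).

Definition word_inv w := rev (map letter_inv w).

Lemma letter_invK : involutive letter_inv.
Proof. by case=> x b; rewrite /letter_inv /= negbK. Qed.

Lemma letter_val_inv l : letter_val (letter_inv l) = (letter_val l)^-1.
Proof. by case: l => x []; rewrite /letter_val //= invgK. Qed.

Lemma word_val_nil : word_val [::] = 1 :> F.
Proof. by rewrite /word_val big_nil. Qed.

Lemma word_val_cons l w : word_val (l :: w) = letter_val l * word_val w.
Proof. by rewrite /word_val big_cons. Qed.

Lemma word_val_cat w1 w2 : word_val (w1 ++ w2) = word_val w1 * word_val w2.
Proof. by rewrite /word_val big_cat. Qed.

Lemma word_val_rcons w l : word_val (rcons w l) = word_val w * letter_val l.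
Proof. by rewrite -cats1 word_val_cat word_val_cons word_val_nil mulg1. Qed.

Lemma word_inv_cons l w : word_inv (l :: w) = rcons (word_inv w) (letter_inv l).
Proof. by rewrite /word_inv map_cons rev_cons. Qed.

Lemma word_inv_rcons l w : word_inv (rcons w l) = letter_inv l :: word_inv w.
Proof. by rewrite /word_inv map_rcons rev_rcons. Qed.

Lemma word_val_inv w : word_val (word_inv w) = (word_val w)^-1.
Proof.
elim: w => [|l w IH]; first by rewrite word_val_nil invg1.
by rewrite word_inv_cons word_val_rcons IH word_val_cons letter_val_inv invgM.
Qed.

Lemma word_over_cons S l w :
  word_over S (l :: w) <-> S l.1 /\ word_over S w.
Proof.
split=> [h|[h1 h2] k]; last by rewrite inE => /orP[/eqP->|/h2].
by split=> [|k kw]; apply: h; rewrite inE ?eqxx ?kw ?orbT.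
Qed.

Lemma word_over_cat S w1 w2 :
  word_over S (w1 ++ w2) <-> word_over S w1 /\ word_over S w2.
Proof.
split=> [h|[h1 h2] k]; last by rewrite mem_cat => /orP[/h1|/h2].
by split=> k kw; apply: h; rewrite mem_cat kw ?orbT.
Qed.

Lemma word_over_inv S w : word_over S w -> word_over S (word_inv w).
Proof. by move=> h k; rewrite mem_rev => /mapP[l /h ? ->]. Qed.

Lemma word_over_sub S T w : S `<=` T -> word_over S w -> word_over T w.
Proof. by move=> ST h l /h /ST. Qed.

Section Subgroup.
Variable H : set F.
Hypothesis hH : subgroup H.

Lemma subgroup1 : H 1.
Proof. by case: hH => /set_mem. Qed.

Lemma subgroupF x y : H x -> H y -> H (x / y).
Proof. by case: hH => _ h /mem_set ? /mem_set ?; apply/set_mem/h. Qed.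

Lemma subgroupV x : H x -> H x^-1.
Proof. by move=> Hx; rewrite -div1g; apply: subgroupF subgroup1 Hx. Qed.

Lemma subgroupM x y : H x -> H y -> H (x * y).
Proof. by move=> Hx /subgroupV Hy; rewrite -[y]invgK; apply: subgroupF. Qed.

Lemma subgroup_letter l : H l.1 -> H (letter_val l).
Proof. by case: l => x [] //=; apply: subgroupV. Qed.

Lemma subgroup_word w : word_over H w -> H (word_val w).
Proof.
elim: w => [|l w IH]; first by rewrite word_val_nil => _; apply: subgroup1.
case/word_over_cons=> Hl /IH Hw; rewrite word_val_cons.
exact: subgroupM (subgroup_letter Hl) Hw.
Qed.

End Subgroup.

Lemma subgroupP H : H 1 -> (forall x y, H x -> H y -> H (x / y)) -> subgroup H.
Proof.
move=> H1 HF; split; first exact: mem_set.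
by move=> x y /set_mem Hx /set_mem Hy; apply/mem_set/HF.
Qed.

Lemma subgroupI H K : subgroup H -> subgroup K -> subgroup (H `&` K).
Proof.
move=> hH hK; apply: subgroupP => [|x y [Hx Kx] [Hy Ky]].
  by split; apply: subgroup1.
by split; apply: subgroupF.
Qed.

Lemma generated_sub S H : subgroup H -> S `<=` H -> generated S `<=` H.
Proof. by move=> hH SH; apply: smallest_sub. Qed.

Lemma sub_generated S : S `<=` generated S.
Proof. exact: sub_gen_smallest. Qed.

Lemma generated_subgroup S : subgroup (generated S).
Proof.
apply: subgroupP => [H [hH _]|x y Sx Sy H [hH SH]]; first exact: subgroup1.
by apply: subgroupF => //; [apply: Sx|apply: Sy].
Qed.

Lemma generatedS S T : S `<=` T -> generated S `<=` generated T.
Proof.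
move=> ST; apply: generated_sub; first exact: generated_subgroup.
by move=> x /ST; apply: sub_generated.
Qed.

Lemma generatedP S x :
  generated S x <-> exists2 w, word_over S w & word_val w = x.
Proof.
split=> [|[w Sw <-]]; last first.
  apply: subgroup_word; first exact: generated_subgroup.
  exact: word_over_sub (@sub_generated S) Sw.
move: x; apply: generated_sub => [|x Sx]; last first.
  exists [:: (x, false)]; first by move=> l; rewrite inE => /eqP->.
  by rewrite word_val_cons word_val_nil mulg1.
apply: subgroupP => [|x y [w Sw <-] [w' Sw' <-]].
  by exists [::] => //; rewrite word_val_nil.
exists (w ++ word_inv w'); last by rewrite word_val_cat word_val_inv.
by apply/word_over_cat; split=> //; apply: word_over_inv.
Qed.

Lemma generated_ind S (P : F -> Prop) :
  P 1 -> (forall x l, generated S x -> P x -> S l.1 -> P (x * letter_val l)) ->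
  forall x, generated S x -> P x.
Proof.
move=> P1 PM x /generatedP[w Sw <-]; elim/last_ind: w Sw => [|w l IH].
  by rewrite word_val_nil.
rewrite -cats1 => /word_over_cat[Sw /word_over_cons[Sl _]].
rewrite cats1 word_val_rcons; apply: PM => //; last exact: IH.
by apply/generatedP; exists w.
Qed.

(** Left multiplication by a letter on reduced words. By [push_invK] these maps are permutations:
    this is the van der Waerden action of the free group. *)
Definition push l w :=
  if w is k :: w' then if k == letter_inv l then w' else l :: w else [:: l].

Definition reduce w := foldr push [::] w.

Lemma reduced_cons2 l k w :
  reduced [:: l, k & w] = (k != letter_inv l) && reduced (k :: w).
Proof.
rewrite /reduced /=; congr (~~ _ && _).
case: l k => [x b] [y c]; rewrite /letter_inv xpair_eqE eq_sym /=.
by case: b c => [] [].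
Qed.

Lemma reduced_behead l w : reduced (l :: w) -> reduced w.
Proof. by case: w => // k w; rewrite reduced_cons2 => /andP[]. Qed.

Lemma reduced_push l w : reduced w -> reduced (push l w).
Proof.
case: w => // k w; rewrite /push; case: ifP => [_|]; first exact: reduced_behead.
by move=> kl rw; rewrite reduced_cons2 kl.
Qed.

Lemma push_reduced l w : reduced (l :: w) -> push l w = l :: w.
Proof. by case: w => // k w; rewrite reduced_cons2 /= => /andP[/negPf->]. Qed.

Lemma push_invK l w : reduced w -> push (letter_inv l) (push l w) = w.
Proof.
case: w => [|k w] rw; rewrite /push; first by rewrite letter_invK eqxx.
case: ifP => [/eqP kl|_]; last by rewrite letter_invK eqxx.
case: w rw => [|k' w]; first by rewrite kl.
by rewrite -kl reduced_cons2 => /andP[/negPf->].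
Qed.

Lemma reduced_reduce w : reduced (reduce w).
Proof. by elim: w => //= l w; apply: reduced_push. Qed.

Lemma word_val_push l w : word_val (push l w) = letter_val l * word_val w.
Proof.
case: w => [|k w]; rewrite /push; first by rewrite word_val_cons.
case: ifP => [/eqP->|_]; last by rewrite word_val_cons.
by rewrite word_val_cons letter_val_inv mulVKg.
Qed.

Lemma word_val_reduce w : word_val (reduce w) = word_val w.
Proof.
elim: w => //= l w IH.
by rewrite word_val_push IH word_val_cons.
Qed.

Lemma word_over_push S l w :
  S l.1 -> word_over S w -> word_over S (push l w).
Proof.
case: w => [|k w] Sl Sw; rewrite /push; first exact/word_over_cons.
case: ifP => _; first by case/word_over_cons: Sw.
exact/word_over_cons.
Qed.

Lemma word_over_reduce S w : word_over S w -> word_over S (reduce w).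
Proof.
elim: w => //= l w IH /word_over_cons[Sl /IH]; exact: word_over_push.
Qed.

(** As long as nothing cancels, pushing letters from left to right stacks them in reverse order;
    [w2] is the accumulator that the induction needs. *)
Lemma foldl_push_catrev w1 w2 :
  reduced (catrev w1 w2) -> foldl (fun w l => push l w) w2 w1 = catrev w1 w2.
Proof.
elim: w1 w2 => //= l w1 IH w2 h.
suff rl : reduced (l :: w2) by rewrite push_reduced // IH.
by elim: w1 (l :: w2) h {IH} => //= k w1 IH w h; apply: reduced_behead (IH _ h).
Qed.

Lemma reduced_rev w : reduced (rev w) = reduced w.
Proof.
rewrite /reduced rev_sorted; case: w => //= l w.
apply: eq_path => k k'; rewrite eq_sym [k.2 == _]eq_sym //.
Qed.

Lemma foldl_push w : reduced w -> foldl (fun w l => push l w) [::] w = rev w.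
Proof. by move=> rw; rewrite foldl_push_catrev // -/(rev w) reduced_rev. Qed.

(* Any assignment of mutually inverse maps to the letters is an action of the
   free group: a word with value 1 acts trivially. *)
Lemma free_action K B (T : Type) (D : set T) (act : T -> F * bool -> T) :
  free_basis K B ->
  (forall t l, B l.1 -> D t -> D (act t l)) ->
  (forall t l, B l.1 -> D t -> act (act t l) (letter_inv l) = t) ->
  forall w1 w2 t, word_over B w1 -> word_over B w2 ->
  word_val w1 = word_val w2 -> D t -> foldl act t w1 = foldl act t w2.
Proof.
move=> [_ hB] actD actK.
have foldD w t : word_over B w -> D t -> D (foldl act t w).
  elim: w t => //= l w IH t /word_over_cons[Bl Bw] Dt.
  by apply: IH => //; apply: actD.
have red w t : word_over B w -> D t -> foldl act t w = foldl act t (reduce w).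
  elim: w t => //= l w IH t /word_over_cons[Bl Bw] Dt.
  rewrite IH //; last exact: actD.
  have := reduced_reduce w; have := word_over_reduce Bw.
  case: (reduce w) => [|k w'] //; rewrite /push => /word_over_cons[Bk Bw'] _.
  by case: ifP => [/eqP->|//] /=; rewrite actK.
have triv w t : word_over B w -> D t -> word_val w = 1 -> foldl act t w = t.
  move=> Bw Dt w1; rewrite red //.
  case: (reduce w =P [::]) => [->//|/eqP nz].
  move: (hB _ (word_over_reduce Bw) (reduced_reduce w) nz).
  by rewrite word_val_reduce w1 eqxx.
have invw w t : word_over B w -> D t -> foldl act (foldl act t w) (word_inv w) = t.
  elim: w t => //= l w IH t /word_over_cons[Bl Bw] Dt.
  rewrite word_inv_cons -cats1 foldl_cat IH //=; last exact: actD.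
  exact: actK.
move=> w1 w2 t Bw1 Bw2 e Dt.
have Bw2' := word_over_inv Bw2.
rewrite -[LHS](@invw (word_inv w2)) //; last exact: foldD.
have -> : word_inv (word_inv w2) = w2.
  by rewrite /word_inv map_rev revK -map_comp map_id_in // => l _ /=; rewrite letter_invK.
congr (foldl _ _ _); rewrite -foldl_cat triv //; first exact/word_over_cat.
by rewrite word_val_cat word_val_inv e mulgV.
Qed.

End Words.

(** * Cochains with values in Z/2 *)

(** Replaces comparison of dimensions over Z/2; no linearity of [f] is needed, since finite function
    spaces can be counted. *)
Lemma leq_card_ffun_bool (A B : finType)
    (f : {ffun A -> bool} -> {ffun B -> bool}) :
  injective f -> (#|A| <= #|B|)%N.
Proof. by move/leq_card; rewrite !card_ffun card_bool leq_exp2l. Qed.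

Section Potentials.
Variable F : groupType.
Implicit Types (H K B S : set F) (c : F -> F -> bool) (phi : F -> bool).

(** [c f b] is the value of a 1-cochain on the Cayley graph edge from [f] to [f * b]; [phi] is its
    primitive normalised at 1. *)
Definition is_potential K B c phi :=
  phi 1 = false /\
  forall f b, K f -> B b -> phi (f * b) = phi f (+) c f b.

Lemma potentialV K B c phi f b : subgroup K -> B `<=` K ->
  is_potential K B c phi -> K f -> B b ->
  phi (f / b) = phi f (+) c (f / b) b.
Proof.
move=> hK BK [_ h] Kf Bb; have Kfb := subgroupF hK Kf (BK _ Bb).
by have := h _ _ Kfb Bb; rewrite mulgVK => ->; rewrite addbK.
Qed.

Lemma potential_unique B c phi psi : let K := generated B in
  is_potential K B c phi -> is_potential K B c psi ->
  forall f, K f -> phi f = psi f.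
Proof.
move=> K hphi hpsi; have hK : subgroup K := @generated_subgroup _ B.
have BK : B `<=` K := @sub_generated _ B.
apply: generated_ind; first by case: hphi hpsi => -> _ [-> _].
move=> f [b []] Kf e /= Bb; rewrite /letter_val /=.
  by rewrite (potentialV hK BK hphi) // (potentialV hK BK hpsi) // e.
by case: hphi hpsi => _ -> // [_ ->] //; rewrite e.
Qed.

(** Follows from uniqueness: as [c] is invariant under [g], the function [phi g (+) phi (g * f)] of
    [f] is again a potential of [c]. *)
Lemma potential_translate B c phi g : let K := generated B in
  is_potential K B c phi -> K g ->
  (forall f b, K f -> B b -> c (g * f) b = c f b) ->
  forall f, K f -> phi (g * f) = phi g (+) phi f.
Proof.
move=> K hphi Kg cg f Kf; have hK : subgroup K := @generated_subgroup _ B.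
suff /potential_unique/(_ hphi f Kf) <- :
    is_potential K B c (fun f => phi g (+) phi (g * f)) by rewrite addKb.
split=> [|f' b Kf' Bb]; first by rewrite mulg1 addbb.
by rewrite mulgA (proj2 hphi (g * f')) ?cg ?addbA //; apply: (subgroupM hK).
Qed.

(** The sum of [c] along a path depends only on its end, because the letters act on pairs of a
    vertex and a running sum, and [free_action] applies. *)
Lemma exists_potential K B c : free_basis K B ->
  exists phi, is_potential K B c phi.
Proof.
move=> hB; have [gB _] := hB.
(* An inverse letter crosses, backwards, the edge that issues from [t.1 / l.1]. *)
pose act (t : F * bool) (l : F * bool) :=
  let f := if l.2 then t.1 / l.1 else t.1 in
  (t.1 * letter_val l, t.2 (+) c f l.1).
pose word f := xget [::] [set w | word_over B w /\ word_val w = f].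
have wordP f : K f -> word_over B (word f) /\ word_val (word f) = f.
  rewrite -gB => /generatedP[w Bw vw].
  by apply: (@xgetPex _ _ [set w | word_over B w /\ _]); exists w.
have act1 t w : (foldl act t w).1 = t.1 * word_val w.
  elim: w t => [|l w IH] t /=; first by rewrite word_val_nil mulg1.
  by rewrite IH word_val_cons mulgA.
have actK t l : B l.1 -> [set: F * bool] t -> act (act t l) (letter_inv l) = t.
  move=> _ _; case: t l => f s [b []];
  rewrite /act /letter_val /letter_inv /= ?mulgK ?mulgVK -?addbA ?addbb ?addbF //.
have actw := @free_action _ _ _ _ [set: F * bool] act hB (fun _ _ _ _ => I) actK.
exists (fun f => (foldl act (1, false) (word f)).2); split.
  have [|Bw vw] := wordP 1.
    by rewrite -gB; exact: subgroup1 (@generated_subgroup _ B).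
  by rewrite (actw _ [::]) // vw word_val_nil.
move=> f b Kf Bb; have [Bw vw] := wordP _ Kf.
have [|Bw' vw'] := wordP (f * b).
  rewrite -gB in Kf *.
  exact: (subgroupM (@generated_subgroup _ B) Kf (sub_generated Bb)).
rewrite (actw _ (rcons (word f) (b, false))) //; first last.
- by rewrite vw' word_val_rcons vw.
- by rewrite -cats1; apply/word_over_cat; split=> // l; rewrite inE => /eqP->.
by rewrite foldl_rcons /= act1 mul1g vw.
Qed.

(** A cochain depending only on the label of an edge is invariant under all translations, so its
    potential is a homomorphism. *)
Lemma free_basis_hom K B (c : F -> bool) : free_basis K B ->
  exists phi : F -> bool,
    (forall f g, K f -> K g -> phi (f * g) = phi f (+) phi g) /\
    (forall b, B b -> phi b = c b).
Proof.
move=> hB; have [phi] := exists_potential (fun _ => c) hB.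
case: hB => gB _; rewrite -gB => hphi; exists phi.
split=> [f g Kf Kg|b Bb]; first exact: potential_translate hphi _ _ _ _.
rewrite -[in LHS](mul1g b) (proj2 hphi) ?(proj1 hphi) //.
exact: subgroup1 (@generated_subgroup _ B).
Qed.

(** Homomorphisms to Z/2 can be prescribed freely on the basis elements [t], but are determined by
    their values on the generators [s]. *)
Lemma free_basis_size_le K B (s t : seq F) : free_basis K B ->
  K = generated [set` s] -> uniq t -> [set` t] `<=` B -> (size t <= size s)%N.
Proof.
move=> hB Ks ut tB.
pose ext (d : {ffun seq_sub t -> bool}) b := oapp d false (insub b).
have /choice[phi hphi] d := free_basis_hom (ext d) hB.
rewrite -(card_seq_sub ut) -[size s]card_ord.
apply: (@leq_card_ffun_bool _ _ (fun d => [ffun j : 'I_(size s) => phi d (nth 1 s j)])).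
move=> d d' e; have {}e : forall x, K x -> phi d x = phi d' x.
  have [h _] := hphi d; have [h' _] := hphi d'.
  have hK : subgroup K by rewrite Ks; apply: generated_subgroup.
  have hom1 p : (forall f g, K f -> K g -> p (f * g) = p f (+) p g) -> p 1 = false.
    by move=> /(_ 1 1 (subgroup1 hK) (subgroup1 hK)); rewrite mulg1; case: (p 1).
  have homV p x : (forall f g, K f -> K g -> p (f * g) = p f (+) p g) ->
      K x -> p x^-1 = p x.
    move=> hp Kx; have := hp x _ Kx (subgroupV hK Kx).
    by rewrite mulgV hom1 //; case: (p x); case: (p _).
  rewrite Ks; apply: generated_ind; first by rewrite !hom1.
  move=> f l; rewrite -Ks => Kf ef sl; have Kl : K l.1 by rewrite Ks; apply: sub_generated.
  have el : phi d l.1 = phi d' l.1.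
    move: sl; rewrite /= => sl; have := sl; rewrite -index_mem => lts.
    move/ffunP: e => /(_ (Ordinal lts)); rewrite !ffunE /= !nth_index //.
  rewrite h ?h' //; try exact: subgroup_letter.
  by rewrite ef; case: (l) el Kl => b [] //= el Kl; rewrite /letter_val /= ?homV // el.
apply/ffunP=> u; have Bu := tB _ (ssvalP u).
have Ku : K (ssval u) by case: (hB) => <- _; apply: sub_generated.
have := e _ Ku; rewrite (proj2 (hphi d)) // (proj2 (hphi d')) //.
by rewrite /ext -[ssval u]/(val u) valK.
Qed.

End Potentials.

(** * A left order on a free group *)

Section LeftOrder.
Variables (F : groupType) (X : seq F).
Hypothesis hX : free_basis [set: F] [set` X].
Implicit Types (w a b c : seq (F * bool)) (l k : F * bool).
Implicit Types (p q r : option (F * bool)).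

(** Acting on [[::]] through [push], a reduced word produces its own reverse, and by [free_action]
    the result depends only on the value of the word. *)
Lemma reduced_inj w1 w2 : word_over [set` X] w1 -> word_over [set` X] w2 ->
  reduced w1 -> reduced w2 -> word_val w1 = word_val w2 -> w1 = w2.
Proof.
move=> X1 X2 r1 r2 e; apply: (can_inj revK); rewrite -!foldl_push //.
apply: (free_action (D := [set w | reduced w])) hX _ _ _ _ _ _ _ _ _ => //.
- by move=> w l _; apply: reduced_push.
- by move=> w l _; apply: push_invK.
Qed.

Definition normal_form (f : F) : seq (F * bool) :=
  xget [::] [set w | [/\ word_over [set` X] w, reduced w & word_val w = f]].

Lemma normal_formP f :
  [/\ word_over [set` X] (normal_form f), reduced (normal_form f)
    & word_val (normal_form f) = f].
Proof.
apply: (@xgetPex _ _ [set w | [/\ word_over [set` X] w, _ & word_val w = f]]).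
have : [set: F] f by []; case: hX => <- _ /generatedP[w Xw <-].
exists (reduce w); split; first exact: word_over_reduce.
  exact: reduced_reduce.
exact: word_val_reduce.
Qed.

Lemma normal_form_val w : word_over [set` X] w -> reduced w ->
  normal_form (word_val w) = w.
Proof.
by move=> Xw rw; have [Xn rn e] := normal_formP (word_val w); apply: reduced_inj.
Qed.

Lemma reduced_word_inv w : reduced (word_inv w) = reduced w.
Proof.
rewrite reduced_rev; elim: w => // l [//|k w] IH.
rewrite reduced_cons2 -IH !map_cons reduced_cons2; congr (~~ _ && _).
by rewrite (can_eq (@letter_invK F)).
Qed.

Lemma word_invK : involutive (@word_inv F).
Proof.
move=> w; rewrite /word_inv map_rev revK -map_comp map_id_in // => l _ /=.
exact: letter_invK.
Qed.

(* The direction in which a path that starts by following [a] points back,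
   given that it pointed back to [p] at the beginning; [None] is the extra
   direction attached to every vertex. *)
Definition back p a := foldl (fun _ l => Some (letter_inv l)) p a.

Definition ahead a q := if a is l :: _ then Some l else q.

Definition direction_rank p :=
  if p is Some l then ((index l.1 X).*2 + l.2).+1 else 0.

Definition orientation p q : Z :=
  if (direction_rank p < direction_rank q)%N then 1%Z
  else if (direction_rank q < direction_rank p)%N then (-1)%Z else 0%Z.

Definition letter_sign l : Z := if l.2 then (-1)%Z else 1%Z.

(** Adds up turns and letter signs along the path spelled by [w], where [p] is the direction
    pointing back at its start and [q] the direction of departure at its end. *)
Fixpoint winding p w q : Z :=
  if w is l :: w' then
    (orientation p (Some l) + letter_sign l + winding (Some (letter_inv l)) w' q)%Z
  else orientation p q.

Lemma orientationN p q : orientation q p = (- orientation p q)%Z.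
Proof. by rewrite /orientation; case: ltngtP. Qed.

Definition in_basis p := if p is Some l then l.1 \in X else true.

Lemma direction_rank_inj p q : in_basis p -> in_basis q ->
  direction_rank p = direction_rank q -> p = q.
Proof.
case: p q => [[x b]|] [[y d]|] //= Xx Xy [].
move=> /[dup] /(congr1 half) + /(congr1 odd).
rewrite !halfD !oddD !odd_double !doubleK /= => + bd.
have {bd} -> : b = d by move: bd; case: b d => [] [].
by case: d; rewrite /= !addn0 => /index_inj -> //.
Qed.

Lemma orientation_neq p q : in_basis p -> in_basis q -> p <> q ->
  orientation p q = 1%Z \/ orientation p q = (-1)%Z.
Proof.
move=> bp bq pq; rewrite /orientation.
by case: ltngtP => [|| /(direction_rank_inj bp bq)]; auto.
Qed.

(** Going once around three distinct ranks meets two ascents and one descent, or the reverse. *)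
Lemma tripod p q r : in_basis p -> in_basis q -> in_basis r ->
  p <> q -> q <> r -> r <> p ->
  let s := (orientation p q + orientation q r + orientation r p)%Z in
  s = 1%Z \/ s = (-1)%Z.
Proof.
move=> bp bq br pq qr rp; rewrite /orientation.
have h1 := contra_not (@direction_rank_inj _ _ bp bq) pq.
have h2 := contra_not (@direction_rank_inj _ _ bq br) qr.
have h3 := contra_not (@direction_rank_inj _ _ br bp) rp.
move: h1 h2 h3; move: (direction_rank p) (direction_rank q) (direction_rank r).
move=> i j k; case: (ltngtP i j) => // hij _; case: (ltngtP j k) => // hjk _;
  case: (ltngtP k i) => // hki _ /=; try lia.
  by have := ltn_trans (ltn_trans hij hjk) hki; rewrite ltnn.
by have := ltn_trans (ltn_trans hki hjk) hij; rewrite ltnn.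
Qed.

Lemma winding_cat p a l b q : winding p (a ++ l :: b) q =
  (winding p a (Some l) + letter_sign l + winding (Some (letter_inv l)) b q)%Z.
Proof. by elim: a p => //= k a IH p; rewrite IH; lia. Qed.

Lemma winding_inv p w q : winding q (word_inv w) p = (- winding p w q)%Z.
Proof.
elim: w p => [|l w IH] p; first exact: orientationN.
rewrite word_inv_cons -cats1 winding_cat /= IH letter_invK (orientationN p).
by have -> : letter_sign (letter_inv l) = (- letter_sign l)%Z; [case: l => x []|lia].
Qed.

(** The direction of departure enters only into the last turn. With [winding_ahead], its analogue
    for the first turn, this normalises the ends of the legs of a tripod. *)
Lemma winding_back p a q q' : winding p a q =
  (winding p a q' + orientation (back p a) q - orientation (back p a) q')%Z.
Proof. by elim: a p => [|l a IH] p /=; [|rewrite IH]; lia. Qed.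

Lemma winding_split p a b q : winding p (a ++ b) q =
  (winding p a (ahead b q) + winding (back p a) b q
   - orientation (back p a) (ahead b q))%Z.
Proof.
case: b => [|l b] /=; first by rewrite cats0; lia.
rewrite winding_cat; elim: a p => [|k a IH] p /=; first by lia.
by have := IH (Some (letter_inv k)); lia.
Qed.

Lemma winding_ahead p p' b q : winding p b q =
  (winding p' b q + orientation p (ahead b q) - orientation p' (ahead b q))%Z.
Proof. by case: b => [|l b] /=; lia. Qed.

Lemma back_inv p w : back p (word_inv w) = ahead w p.
Proof. by case: w => //= l w; rewrite word_inv_cons /back foldl_rcons letter_invK. Qed.

Lemma ahead_inv w q : ahead (word_inv w) q = back q w.
Proof. by rewrite -[in RHS](word_invK w) back_inv. Qed.

(** Inside a reduced path the directions back and ahead differ by reducedness; at an end exactly one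
    of them is [None], the path being nonempty. *)
Lemma reduced_cat a b : reduced (a ++ b) -> a ++ b != [::] ->
  back None a <> ahead b None.
Proof.
elim/last_ind: a => [|a l _]; first by case: b.
rewrite /back foldl_rcons cat_rcons; case: b => //= k b + _ [e].
elim: a => [|k' a IH /reduced_behead //].
by rewrite cat0s reduced_cons2 e eqxx.
Qed.

Lemma reduced_catl a b : reduced (a ++ b) -> reduced a.
Proof. by rewrite /reduced => /cat_sorted2[]. Qed.

Lemma winding_odd w p : reduced w -> word_over [set` X] w -> in_basis p ->
  p <> ahead w None -> exists k : Z, winding p w None = (k + k + 1)%Z.
Proof.
elim: w p => [|l w IH] p rw Xw bp /= np.
  by case: (@orientation_neq p None) => // ->; [exists 0%Z|exists (-1)%Z].
have [Xl Xw'] := (word_over_cons _ _ _).1 Xw.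
have [] := IH (Some (letter_inv l)) => //.
- exact: reduced_behead rw.
- by case: w rw {IH Xw Xw'} => // k w; rewrite reduced_cons2 => /andP[/eqP h _] [/esym].
move=> k ->; rewrite /letter_sign.
case: (@orientation_neq p (Some l)) => // ->; case: l.2.
- by exists k; lia.
- by exists (k + 1)%Z; lia.
- by exists (k - 1)%Z; lia.
- by exists k; lia.
Qed.

(** [c] is the part of [u] that cancels in the product: last letters of [u] are matched with first
    letters of [v] up to the first mismatch. *)
Lemma reduced_decomposition u v : reduced u -> reduced v ->
  exists a b c, [/\ u = a ++ c, v = word_inv c ++ b & reduced (a ++ b)].
Proof.
elim/last_ind: u v => [|u l IH] v ru rv.
  by exists [::], v, [::]; split.
have ru' : reduced u by move: ru; rewrite -cats1; apply: reduced_catl.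
case: v rv => [|k v] rv; first by exists (rcons u l), [::], [::]; rewrite !cats0.
case: (k =P letter_inv l) => [->|kl].
  have [a [b [c [ua vb rab]]]] := IH v ru' (reduced_behead rv).
  exists a, b, (rcons c l); rewrite ua rcons_cat; split=> //.
  by rewrite vb word_inv_rcons.
exists (rcons u l), (k :: v), [::]; rewrite cats0; split=> //.
rewrite cat_rcons; have lk : reduced [:: l, k & v].
  by rewrite reduced_cons2 rv andbT; apply/eqP.
elim: u ru {IH ru'} => // k' u IH; rewrite rcons_cons cat_cons.
case: u IH => [_|k'' u IH].
  by rewrite -[rcons _ _]/[:: l] cat0s !(reduced_cons2 k') lk => /andP[->].
by rewrite rcons_cons cat_cons !(reduced_cons2 k') => /andP[-> /IH].
Qed.

(* A normal form of length k > 0 has k letter signs and k + 1 turns, each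
   contributing 1 or -1, so its signature is odd; since the signature is additive
   up to 1 or -1, the elements of positive signature form a positive cone. *)
Definition signature f := winding None (normal_form f) None.

Lemma signature1 : signature 1 = 0%Z.
Proof. by rewrite -(word_val_nil F) /signature normal_form_val. Qed.

Lemma signatureV f : signature f^-1 = (- signature f)%Z.
Proof.
have [Xw rw e] := normal_formP f; rewrite /signature -{1}e -word_val_inv.
rewrite normal_form_val ?winding_inv ?reduced_word_inv //.
exact: word_over_inv.
Qed.

Lemma signature_odd f : f <> 1 -> exists k : Z, signature f = (k + k + 1)%Z.
Proof.
have [Xw rw e] := normal_formP f => f1; apply: winding_odd => //.
case: (normal_form f) e => // e; case: f1; rewrite -e; exact: word_val_nil.
Qed.

Lemma in_basis_ahead w : word_over [set` X] w -> in_basis (ahead w None).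
Proof. by case: w => //= l w /word_over_cons[]. Qed.

Lemma in_basis_back w : word_over [set` X] w -> in_basis (back None w).
Proof. by move/word_over_inv/in_basis_ahead; rewrite ahead_inv. Qed.

(* The normal forms of [f], [g] and [f g] run along the three legs of the
   tripod spanned by the vertices 1, [f] and [f g]; the contributions of the
   legs cancel and only the three turns at the centre remain. *)
Lemma signatureM f g : f <> 1 -> g <> 1 -> f * g <> 1 ->
  let d := (signature f + signature g - signature (f * g))%Z in
  d = 1%Z \/ d = (-1)%Z.
Proof.
move=> f1 g1 fg1 d; rewrite {}/d.
have [Xu ru eu] := normal_formP f; have [Xv rv ev] := normal_formP g.
have [a [b [c [ua vb rab]]]] := reduced_decomposition ru rv.
move: Xu Xv; rewrite ua vb => /word_over_cat[Xa Xc] /word_over_cat[Xc' Xb].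
have vab : word_val (a ++ b) = f * g.
  by rewrite -eu -ev ua vb !word_val_cat word_val_inv mulgA mulgK.
have nz w h : word_val w = h -> h <> 1 -> w != [::].
  by move=> <-; case: w => //; rewrite word_val_nil.
rewrite -vab in fg1 *; rewrite /signature normal_form_val //; last exact/word_over_cat.
rewrite ua vb !winding_split back_inv.
have n1 : back None a <> ahead c None.
  by apply: reduced_cat; rewrite -ua //; apply: nz eu f1.
have n2 : ahead c None <> ahead b None.
  by rewrite -back_inv; apply: reduced_cat; rewrite -vb //; apply: nz ev g1.
have n3 : back None a <> ahead b None.
  by apply: reduced_cat rab _; apply: nz (erefl _) fg1.
have := tripod (in_basis_back Xa) (in_basis_ahead Xc) (in_basis_ahead Xb) n1 n2 (nesym n3).
rewrite (winding_back None a _ None) (winding_back None a (ahead b None) None).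
rewrite (winding_ahead (back None a) None c) (winding_ahead (back None a) None b).
rewrite (winding_ahead (ahead c None) None b).
have := winding_inv None c None.
rewrite (winding_back None (word_inv c) (ahead b None) None).
rewrite back_inv.
have := orientationN (back None a) (ahead b None).
have := orientationN (ahead c None) None.
have := orientationN (back None a) None.
by move=> /= h1 h2 h3 h4; lia.
Qed.

Theorem free_group_left_order : exists lt : F -> F -> bool,
  [/\ irreflexive lt, transitive lt, forall f g h, lt (h * f) (h * g) = lt f g
    & forall f g, f <> g -> lt f g || lt g f].
Proof.
exists (fun f g => (0 <? signature (f^-1 * g))%Z); split.
- by move=> f; rewrite mulVg signature1.
- move=> g f h /Z.ltb_lt fg /Z.ltb_lt gh; apply/Z.ltb_lt.
  have e : f^-1 * h = (f^-1 * g) * (g^-1 * h) by rewrite mulgA mulgK.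
  have nf (i : F) : (0 < signature i)%Z -> i <> 1.
    by move=> + i1; rewrite i1 signature1; lia.
  have [k1|k1] := eqVneq (f^-1 * h) 1.
    have hf : h = f by rewrite -(mulg1_eq k1) invgK.
    move: gh; have -> : g^-1 * h = (f^-1 * g)^-1 by rewrite hf invgM invgK.
    by rewrite signatureV; lia.
  (* Both signatures are at least 1, so that of the product is at least 1 + 1 - 1. *)
  have [] := @signatureM (f^-1 * g) (g^-1 * h);
    [exact: nf|exact: nf|by rewrite -e; apply/eqP|..];
  rewrite -e; lia.
- by move=> f g h; rewrite invgM mulgA mulgVK.
- move=> f g fg; have [] := @signature_odd (f^-1 * g).
    by move=> /mulg1_eq; rewrite invgK.
  move=> k e; have -> : g^-1 * f = (f^-1 * g)^-1 by rewrite invgM invgK.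
  rewrite signatureV; apply/orP.
  have [?|?] : (0 < signature (f^-1 * g))%Z \/ (signature (f^-1 * g) < 0)%Z by lia.
    by left; apply/Z.ltb_lt.
  by right; apply/Z.ltb_lt; lia.
Qed.

End LeftOrder.

(** * Schreier transversals *)

Lemma exists_min_measure (T : Type) (P : T -> Prop) (m : T -> nat) :
  (exists x, P x) -> exists2 x, P x & forall y, P y -> (m x <= m y)%N.
Proof.
move=> [x Px]; have ex : exists n, `[< exists2 y, P y & m y = n >].
  by exists (m x); apply/asboolP; exists x.
case: (ex_minnP ex) => n /asboolP[y Py <-] min; exists y => // z Pz.
by apply: min; apply/asboolP; exists z.
Qed.

Section NielsenSchreier.
Variables (F : groupType) (X X' : seq F) (H : set F).
Hypotheses (hX : free_basis [set: F] [set` X]) (X'X : {subset X' <= X}).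
Hypothesis hH : subgroup H.
Implicit Types (w t : seq (F * bool)) (l k : F * bool) (f g x : F).

Let digit l := direction_rank X (Some l).

(** A numeral in base 2|X| + 1 without the digit 0, so words of different lengths never share a
    code; comparing codes is the shortlex order. *)
Definition word_code w := foldl (fun a l => a * (size X).*2.+1 + digit l)%N 0%N w.

(** The primary weight. It forces elements of the subgroup generated by [X'] to be represented by
    words over [X'], which makes the Schreier construction relative. *)
Definition letters_outside w := count (fun l => l.1 \notin X') w.

Lemma word_code_rcons w l :
  word_code (rcons w l) = (word_code w * (size X).*2.+1 + digit l)%N.
Proof. by rewrite /word_code foldl_rcons. Qed.

Lemma word_code_inj w1 w2 :
  word_over [set` X] w1 -> word_over [set` X] w2 ->
  word_code w1 = word_code w2 -> w1 = w2.
Proof.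
have dlt l : l.1 \in X -> (digit l < (size X).*2.+1)%N.
  rewrite -index_mem => lt; rewrite /digit /= ltnS.
  move: lt; rewrite -leq_double doubleS; apply: leq_trans.
  by case: l.2; rewrite ?addn1 ?addn0.
elim/last_ind: w1 w2 => [|w1 l1 IH] w2; case/lastP: w2 => [|w2 l2] //.
- by rewrite word_code_rcons /digit addnS.
- by rewrite word_code_rcons /digit addnS.
rewrite -!cats1 => /word_over_cat[X1 /word_over_cons[Xl1 _]].
move=> /word_over_cat[X2 /word_over_cons[Xl2 _]].
rewrite !cats1 !word_code_rcons => e.
have ed : digit l1 = digit l2.
  have := congr1 (modn^~ (size X).*2.+1) e.
  by rewrite !modnMDl !modn_small ?dlt.
move: e; rewrite ed => /addIn/eqP; rewrite eqn_pmul2r // => /eqP/IH -> //.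
by congr rcons; have [] := direction_rank_inj (p := Some l1) (q := Some l2) Xl1 Xl2 ed.
Qed.

Definition lighter w w' : bool :=
  (letters_outside w < letters_outside w')%N ||
  (letters_outside w == letters_outside w') && (word_code w <= word_code w')%N.

Lemma lighter_rcons w w' l : lighter (rcons w l) (rcons w' l) = lighter w w'.
Proof.
rewrite /lighter !word_code_rcons /letters_outside -!cats1 !count_cat.
by rewrite ltn_add2r eqn_add2r leq_add2r leq_pmul2r.
Qed.

Definition coset_word f w := word_over [set` X] w /\ H (word_val w / f).

Definition lightest f w :=
  coset_word f w /\ forall w', coset_word f w' -> lighter w w'.

Lemma lightest_unique f w w' : lightest f w -> lightest f w' -> w = w'.
Proof.
move=> [[Xw Hw] m] [[Xw' Hw'] m']; apply: word_code_inj => //.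
have /orP[h|/andP[/eqP e h]] := m _ (conj Xw' Hw'); have := m' _ (conj Xw Hw);
  rewrite /lighter => /orP[h'|/andP[/eqP e' h']].
- by have := ltn_trans h h'; rewrite ltnn.
- by move: h; rewrite e' ltnn.
- by move: h'; rewrite e ltnn.
- by apply/eqP; rewrite eqn_leq h h'.
Qed.

Definition rep_word f := xget [::] [set w | lightest f w].

Lemma rep_wordP f : lightest f (rep_word f).
Proof.
apply: (@xgetPex _ _ [set w | lightest f w]).
have [w0 w0f] : exists w, coset_word f w.
  have : [set: F] f by []; case: hX => <- _ /generatedP[w Xw <-].
  by exists w; split=> //; rewrite mulgV; apply: subgroup1.
have [w1 w1f min1] := exists_min_measure letters_outside (ex_intro _ w0 w0f).
have [|w [wf ew] min] := @exists_min_measure _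
    (fun w => coset_word f w /\ letters_outside w = letters_outside w1) word_code.
  by exists w1.
exists w; split=> // w' w'f; rewrite /lighter ew.
have := min1 _ w'f; rewrite leq_eqVlt => /orP[/eqP e|->//].
by rewrite e eqxx (min w') ?orbT.
Qed.

Lemma rep_word_coset f g : H (f / g) -> rep_word f = rep_word g.
Proof.
move=> Hfg; have e w : coset_word f w <-> coset_word g w.
  rewrite /coset_word; suff h : H (word_val w / f) <-> H (word_val w / g) by rewrite h.
  split=> Hw.
    have -> : word_val w / g = (word_val w / f) * (f / g) by rewrite mulgA mulgVK.
    exact: subgroupM.
  have -> : word_val w / f = (word_val w / g) / (f / g) by rewrite invgF mulgA mulgVK.
  exact: subgroupF.
apply: (@lightest_unique f); first exact: rep_wordP.
have [h min] := rep_wordP g; split; first exact/e.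
by move=> w /e; apply: min.
Qed.

Lemma rep_word1 : rep_word 1 = [::].
Proof.
apply: (@lightest_unique 1); first exact: rep_wordP.
split; first by split=> //; rewrite word_val_nil mulgV; apply: subgroup1.
by move=> w _; rewrite /lighter /=; case: (letters_outside w).
Qed.

(* Being lightest passes to prefixes, so these words form a Schreier
   transversal. *)
Lemma rep_word_prefix f w l :
  rep_word f = rcons w l -> rep_word (word_val w) = w.
Proof.
move=> e; have [[Xr Hr] min] := rep_wordP f; rewrite e in Xr Hr min.
have [Xw Xl] : word_over [set` X] w /\ word_over [set` X] [:: l].
  by apply/word_over_cat; rewrite cats1.
apply: (@lightest_unique (word_val w)); first exact: rep_wordP.
split=> [|w' [Xw' Hw']]; first by split=> //; rewrite mulgV; apply: subgroup1.
rewrite -(lighter_rcons _ _ l); apply: min; split.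
  by rewrite -cats1; apply/word_over_cat.
move: Hr; rewrite !word_val_rcons => Hr.
have -> : word_val w' * letter_val l / f =
   (word_val w' / word_val w) * (word_val w * letter_val l / f).
  by rewrite !mulgA mulgVK.
exact: subgroupM.
Qed.

Definition rep f := word_val (rep_word f).

Lemma rep_coset f : H (rep f / f).
Proof. by have [[]] := rep_wordP f. Qed.

Lemma eq_rep f g : H (f / g) -> rep f = rep g.
Proof. by rewrite /rep => /rep_word_coset->. Qed.

Lemma rep_mulH g f : H g -> rep (g * f) = rep f.
Proof. by move=> Hg; apply: eq_rep; rewrite mulgK. Qed.

Lemma rep1 : rep 1 = 1.
Proof. by rewrite /rep rep_word1 word_val_nil. Qed.

Definition schreier f x := rep f * x / rep (f * x).

Definition schreier_gens (S : set F) :=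
  [set z | z <> 1 /\ exists f x, [/\ generated S f, S x & z = schreier f x]].

Lemma schreier_in f x : H (schreier f x).
Proof.
have -> : schreier f x = (rep f / f) / (rep (f * x) / (f * x)).
  by rewrite /schreier invgF !mulgA mulgVK.
by apply: subgroupF => //; apply: rep_coset.
Qed.

(** Along a word for [f], the quotient [f / rep f] telescopes into Schreier generators, and it
    equals [f] when [f] lies in [H]. *)
Lemma generated_schreier_gens (S : set F) :
  (forall f, generated S f -> generated S (rep f)) ->
  generated (schreier_gens S) = H `&` generated S.
Proof.
move=> Srep; have gS := @generated_subgroup _ S; apply/seteqP; split.
  apply: generated_sub; first exact: subgroupI.
  move=> _ [_ [f [x [Sf Sx ->]]]]; split; first exact: schreier_in.
  have gx := sub_generated Sx.
  by apply: (subgroupF gS); [|apply: Srep]; apply: (subgroupM gS) => //; apply: Srep.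
have gY := @generated_subgroup _ (schreier_gens S).
have Yin f x : generated S f -> S x -> generated (schreier_gens S) (schreier f x).
  move=> Sf Sx; have [->|/eqP nz] := eqVneq (schreier f x) 1; first exact: subgroup1 gY.
  by apply: sub_generated; split=> //; exists f, x.
suff h f : generated S f -> generated (schreier_gens S) (f / rep f).
  move=> f [Hf /h]; have -> : rep f = 1 by rewrite -rep1; apply: eq_rep; rewrite divg1.
  by rewrite divg1.
move: f; apply: generated_ind; first by rewrite rep1 divg1; apply: (subgroup1 gY).
move=> f [x []] Sf Yf /= Sx; rewrite /letter_val /=; last first.
  have -> : f * x / rep (f * x) = (f / rep f) * schreier f x.
    by rewrite /schreier !mulgA mulgVK.
  by apply: (subgroupM gY) => //; apply: Yin.
have -> : f / x / rep (f / x) = (f / rep f) / schreier (f / x) x.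
  by rewrite /schreier mulgVK !invgM !invgK !mulgA mulgVK.
apply: (subgroupF gY) => //; apply: Yin => //.
by apply: (subgroupF gS) => //; apply: sub_generated.
Qed.

Let pushed l t := if l.1 == 1 then t else push l t.

(** A walk in the Cayley graph that records, as a reduced word, the Schreier generators met on the
    way; trivial generators leave no record. *)
Let act (s : F * seq (F * bool)) l :=
  if l.2 then (s.1 / l.1, pushed (schreier (s.1 / l.1) l.1, true) s.2)
  else (s.1 * l.1, pushed (schreier s.1 l.1, false) s.2).

Let pushedK l t : reduced t -> pushed (letter_inv l) (pushed l t) = t.
Proof. by rewrite /pushed /=; case: eqP => // _; apply: push_invK. Qed.

Let pushed_reduced l t : reduced t -> reduced (pushed l t).
Proof. by rewrite /pushed; case: eqP => // _; apply: reduced_push. Qed.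

Let actK s l : reduced s.2 -> act (act s l) (letter_inv l) = s.
Proof.
case: s l => f t [x []] /= rt; rewrite /act /=.
  rewrite mulgVK -[(schreier _ _, false)]/(letter_inv (schreier (f / x) x, true)).
  by rewrite pushedK.
by rewrite mulgK -[(schreier _ _, true)]/(letter_inv (schreier f x, false)) pushedK.
Qed.

Let act_reduced s l : reduced s.2 -> reduced (act s l).2.
Proof. by rewrite /act; case: l.2 => /= h; apply: pushed_reduced. Qed.

Let actsK w s : reduced s.2 -> foldl act (foldl act s w) (word_inv w) = s.
Proof.
elim: w s => //= l w IH s rs.
by rewrite word_inv_cons foldl_rcons IH ?actK //; apply: act_reduced.
Qed.

Let schreier_mulH g f x : H g -> schreier (g * f) x = schreier f x.
Proof. by move=> Hg; rewrite /schreier -(mulgA g f x) !(rep_mulH _ Hg). Qed.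

(** Representatives are closed under prefixes, so their words run through the Schreier tree, on
    whose edges the Schreier generator is trivial. *)
Let act_rep_word f g t : H g ->
  foldl act (g, t) (rep_word f) = (g * rep f, t).
Proof.
move=> Hg; rewrite /rep; have : rep_word (word_val (rep_word f)) = rep_word f.
  by apply: rep_word_coset; apply: rep_coset.
elim/last_ind: (rep_word f) => [|w l IH] e; first by rewrite word_val_nil mulg1.
have ew := rep_word_prefix e.
rewrite foldl_rcons IH // word_val_rcons.
have re : rep (word_val w) = word_val w by rewrite /rep ew.
have re' : rep (word_val w * letter_val l) = word_val w * letter_val l.
  by rewrite -word_val_rcons /rep e.
case: l e re' => x [] e; rewrite /act /letter_val /pushed /= => re'.
  by rewrite -mulgA schreier_mulH // /schreier mulgVK re re' mulgVK mulgV eqxx.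
by rewrite schreier_mulH // /schreier re re' mulgV eqxx mulgA.
Qed.

Let gen_word f x := rep_word f ++ (x, false) :: word_inv (rep_word (f * x)).

Let gen_word_over f x : x \in X -> word_over [set` X] (gen_word f x).
Proof.
move=> Xx; apply/word_over_cat; split; first by have [[]] := rep_wordP f.
apply/word_over_cons; split=> //; apply: word_over_inv.
by have [[]] := rep_wordP (f * x).
Qed.

Let gen_word_val f x : word_val (gen_word f x) = schreier f x.
Proof. by rewrite word_val_cat word_val_cons word_val_inv mulgA. Qed.

Let act_gen_word f x g t : H g -> reduced t ->
  foldl act (g, t) (gen_word f x) =
  (g * schreier f x, pushed (schreier f x, false) t).
Proof.
move=> Hg rt; rewrite foldl_cat act_rep_word //= /act /=.
have -> : schreier (g * rep f) x = schreier f x.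
  rewrite -(schreier_mulH f x (rep_coset f)) mulgVK schreier_mulH //.
rewrite -[RHS](actsK (rep_word (f * x))); last exact: pushed_reduced.
rewrite act_rep_word; last by apply: subgroupM => //; apply: schreier_in.
by congr (foldl act (_, _) _); rewrite /schreier !mulgA mulgVK.
Qed.

Let act_gen_word_inv f x g t : H g -> reduced t ->
  foldl act (g, t) (word_inv (gen_word f x)) =
  (g / schreier f x, pushed (schreier f x, true) t).
Proof.
move=> Hg rt; rewrite -[RHS](actsK (gen_word f x)); last exact: pushed_reduced.
rewrite act_gen_word; first last.
- exact: pushed_reduced.
- by apply: subgroupF => //; apply: schreier_in.
by rewrite mulgVK -[(_, false)]/(letter_inv (schreier f x, true)) pushedK.
Qed.

(** Rewritten over [X], a word with value 1 must act trivially. But the action records the reverse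
    of the word itself, which is not empty. *)
Lemma schreier_gens_free w : word_over (schreier_gens [set` X]) w ->
  reduced w -> w != [::] -> word_val w != 1.
Proof.
move=> Yw rw nz; apply/eqP => w1.
have [v [Xv vv av]] : exists v, [/\ word_over [set` X] v, word_val v = word_val w
    & forall g t, H g -> reduced t ->
      foldl act (g, t) v = (g * word_val w, foldl (fun t l => push l t) t w)].
  elim: w Yw {rw nz w1} => [_|l w IH /word_over_cons[Yl /IH[v [Xv vv av]]]].
    by exists [::]; split=> // g t _ _; rewrite word_val_nil mulg1.
  case: l Yl => z b [/= nz [f [x [_ Xx ez]]]].
  exists ((if b then word_inv (gen_word f x) else gen_word f x) ++ v); split.
  - apply/word_over_cat; split=> //; case: (b); first apply: word_over_inv;
    exact: gen_word_over.
  - rewrite word_val_cat word_val_cons vv; congr (_ * _); rewrite /letter_val.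
    by case: (b); rewrite ?word_val_inv gen_word_val -ez.
  move=> g t Hg rt; rewrite foldl_cat word_val_cons mulgA /=.
  have -> : push (z, b) t = pushed (z, b) t by rewrite /pushed /=; case: eqP.
  have Hz : H z by rewrite ez; apply: schreier_in.
  by case: (b); rewrite ?act_gen_word ?act_gen_word_inv // -ez av //;
    [apply: subgroupF|apply: pushed_reduced|apply: subgroupM|apply: pushed_reduced].
have : foldl act (1, [::]) v = (1, [::]).
  apply: (free_action (D := [set s | reduced s.2]) hX _ _ (w2 := [::])) => //.
  - by move=> s l _; apply: act_reduced.
  - by move=> s l _; apply: actK.
  by rewrite vv w1 word_val_nil.
rewrite av //; last exact: subgroup1.
by rewrite foldl_push // => -[_ /(congr1 size)/eqP]; rewrite size_rev size_eq0 (negPf nz).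
Qed.

(** This is the free factor statement behind the echelon condition: a basis of the intersection
    extends to one of [H], since the Schreier generators over [X'] are among those over [X]. *)
Theorem relative_nielsen_schreier : exists Y U : set F,
  [/\ U `<=` Y, free_basis H Y & free_basis (H `&` generated [set` X']) U].
Proof.
have XX : [set` X'] `<=` [set` X] by move=> x /X'X.
have UY : schreier_gens [set` X'] `<=` schreier_gens [set` X].
  move=> z [nz [f [x [Xf Xx ez]]]]; split=> //; exists f, x; split=> //.
    exact: generatedS Xf.
  exact: XX.
exists (schreier_gens [set` X]), (schreier_gens [set` X']); split=> //.
  split; last exact: schreier_gens_free.
  by rewrite generated_schreier_gens; case: hX => -> _ //; rewrite setIT.
split; last first.
  by move=> w Uw; apply: schreier_gens_free; apply: word_over_sub Uw.
apply: generated_schreier_gens => f /generatedP[w X'w wf].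
have [[Xr Hr] min] := rep_wordP f; apply/generatedP; exists (rep_word f) => //.
have : lighter (rep_word f) w.
  apply: min; split; first exact: word_over_sub X'w.
  by rewrite wf mulgV; apply: subgroup1.
have w0 : letters_outside w = 0%N.
  by apply/eqP; rewrite eqn0Ngt -has_count; apply/hasPn => l /X'w /= ->.
rewrite /lighter w0 ltn0 /= => /andP[+ _].
by rewrite eqn0Ngt -has_count => /hasPn h l /h; rewrite negbK.
Qed.

End NielsenSchreier.

(** * Essential edges *)

Lemma finite_set_minimum (T : eqType) (lt : rel T) (A : set T) :
  irreflexive lt -> transitive lt -> finite_set A -> A !=set0 ->
  exists2 x, A x & forall y, A y -> ~~ lt y x.
Proof.
move=> irr tr /finite_seqP[s ->] [x0 /= x0s].
suff [x xs h] : exists2 x, x \in s & {in s, forall y, ~~ lt y x} by exists x.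
elim: s {x0s x0} (x0) (x0s) => // a s IH x0 _.
case: s IH => [_|b s IH].
  by exists a; rewrite ?mem_head // => y; rewrite inE => /eqP->; rewrite irr.
have [x xs h] := IH b (mem_head _ _); have [ax|ax] := boolP (lt a x).
  exists a; first exact: mem_head.
  move=> y; rewrite inE => /orP[/eqP->|/h]; first by rewrite irr.
  by apply: contra => ya; apply: tr ax.
exists x; first by rewrite inE xs orbT.
by move=> y; rewrite inE => /orP[/eqP->|/h].
Qed.

Lemma sum_count_mem_le (T : eqType) (s V : seq T) :
  uniq V -> (\sum_(v <- V) count_mem v s <= size s)%N.
Proof.
move=> uV; elim: s => [|a s IH] /=; first by rewrite big1_seq.
rewrite big_split /= -add1n leq_add //.
rewrite (eq_bigr (fun v => nat_of_bool (v == a))); last by move=> v _; rewrite eq_sym.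
by rewrite -big_mkcond /= sum1_count (count_uniq_mem _ uV) leq_b1.
Qed.

Lemma count_le1_inj (T : eqType) (s : seq T) (a : pred T) (x y : T) :
  uniq s -> (count a s <= 1)%N -> x \in s -> y \in s -> a x -> a y -> x = y.
Proof.
move=> us c1 xs ys ax ay; apply/eqP; apply: contraLR c1 => xy.
rewrite -ltnNge -size_filter; apply: (@uniq_leq_size _ [:: x; y]).
  by rewrite /= inE xy.
by move=> z; rewrite !inE mem_filter => /orP[] /eqP->; rewrite ?ax ?ay.
Qed.

Section LabelledGraph.
Variable F : groupType.
Implicit Types (e : F * F) (Q : F * F -> Prop) (f g u v : F) (b : bool).

(* The pair (f, x) stands for the edge from f to f x. *)
Definition endpoint e b : F := if b then e.1 * e.2 else e.1.

Definition translate g e : F * F := (g * e.1, e.2).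

Inductive reach Q f : F -> Prop :=
| reach_refl : reach Q f f
| reach_step e b : reach Q f (endpoint e b) -> Q e ->
    reach Q f (endpoint e (~~ b)).

Lemma reach_trans Q f g u : reach Q f g -> reach Q g u -> reach Q f u.
Proof. by move=> fg; elim=> // e b _ IH Qe; apply: reach_step. Qed.

Lemma reach_sym Q f g : reach Q f g -> reach Q g f.
Proof.
elim=> [|e b _ IH Qe]; first exact: reach_refl.
apply: reach_trans IH; rewrite -[in X in reach _ _ X](negbK b).
by apply: reach_step => //; apply: reach_refl.
Qed.

Lemma reach_sub Q Q' f g : (forall e, Q e -> Q' e) -> reach Q f g -> reach Q' f g.
Proof.
move=> QQ'; elim=> [|e b _ IH /QQ' Qe]; [exact: reach_refl|exact: reach_step].
Qed.

Lemma endpoint_translate g e b : endpoint (translate g e) b = g * endpoint e b.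
Proof. by case: b; rewrite /endpoint /= ?mulgA. Qed.

Lemma translateM g g' e : translate g (translate g' e) = translate (g * g') e.
Proof. by rewrite /translate /= mulgA. Qed.

Lemma translate1 e : translate 1 e = e.
Proof. by case: e => f x; rewrite /translate /= mul1g. Qed.

Lemma translateK g e : translate g^-1 (translate g e) = e.
Proof. by rewrite translateM mulVg translate1. Qed.

Lemma reach_translate Q Q' g f u : (forall e, Q e -> Q' (translate g e)) ->
  reach Q f u -> reach Q' (g * f) (g * u).
Proof.
move=> QQ'; elim=> [|e b _ IH /QQ' Qe]; first exact: reach_refl.
by rewrite -endpoint_translate; apply: reach_step; rewrite ?endpoint_translate.
Qed.

(** * Graphs modulo a subgroup *)

Section Quotient.
Variables (G : set F) (rep : F -> F).
Hypotheses (hG : subgroup G) (rep_in : forall f, G (rep f / f)).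
Hypothesis rep_eq : forall f g, G (f / g) -> rep f = rep g.

(** Quotients are not formed: [rep] selects a vertex in each orbit, and an orbit of edges is
    represented by its member starting at a selected vertex. *)
Definition quotient_edge e : F * F := (rep e.1, e.2).

Definition lifted (E : seq (F * F)) e : Prop := quotient_edge e \in E.

Lemma rep_mul g f : G g -> rep (g * f) = rep f.
Proof. by move=> Gg; apply: rep_eq; rewrite mulgK. Qed.

Lemma rep_inj f g : rep f = rep g -> G (f / g).
Proof.
move=> e; have -> : f / g = (rep f / f)^-1 * (rep g / g).
  by rewrite invgF -e mulgA mulgVK.
by apply: subgroupM => //; apply: subgroupV.
Qed.

Lemma rep_rep f : rep (rep f) = rep f.
Proof. by apply: rep_eq. Qed.

Lemma quotient_edge_translate g e :
  G g -> quotient_edge (translate g e) = quotient_edge e.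
Proof. by move=> Gg; rewrite /quotient_edge /= rep_mul. Qed.

Lemma quotient_edgeE e : quotient_edge e = translate (rep e.1 / e.1) e.
Proof. by rewrite /quotient_edge /translate mulgVK. Qed.

Lemma rep_endpoint e b : rep (endpoint (quotient_edge e) b) = rep (endpoint e b).
Proof. by rewrite quotient_edgeE endpoint_translate rep_mul. Qed.

Lemma lifted_translate E g e : G g -> lifted E (translate g e) = lifted E e.
Proof. by move=> Gg; rewrite /lifted quotient_edge_translate. Qed.

Definition component E v : set F := [set u | reach (lifted E) v u].

(* Induction on the number of vertices: a graph with fewer edges than vertices
   has an isolated vertex or a leaf, which can be pruned. *)
Lemma exists_finite_component E V : uniq V -> uniq E ->
  {in E, forall e, quotient_edge e = e} -> {in V, forall v, rep v = v} ->
  (forall e b, e \in E -> rep (endpoint e b) \in V) ->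
  (size E < size V)%N -> exists2 v, v \in V & finite_set (component E v).
Proof.
have [n] := ubnP (size V); elim: n => // n IH in E V *.
rewrite ltnS => Vn uV uE qE rV VE EV.
pose ends := [seq (e, b) | e <- E, b <- [:: false; true]].
pose at_vertex v (p : (F * F) * bool) := rep (endpoint p.1 p.2) == v.
(* If every vertex had degree at least 2, the 2|E| ends of edges would force |V| <= |E|. A loop
   counts twice. *)
have [v vV cv] : exists2 v, v \in V & (count (at_vertex v) ends <= 1)%N.
  apply: contrapT => no; move: EV; rewrite ltnNge => /negP; apply.
  have := sum_count_mem_le [seq rep (endpoint p.1 p.2) | p <- ends] uV.
  rewrite size_map size_allpairs /= muln2 => h; rewrite -leq_double.
  apply: leq_trans h; rewrite -muln2 -sum1_size big_distrl /=.
  rewrite !big_seq; apply: leq_sum => v vV; rewrite count_map mul1n ltnNge.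
  by apply/negP => c1; apply: no; exists v.
have in_ends e b : e \in E -> (e, b) \in ends.
  by move=> eE; apply/allpairsP; exists (e, b); split=> //; case: b.
have uends : uniq ends by apply: allpairs_uniq => // -[? ?] [? ?].
have endP e b : lifted E e -> rep (endpoint e b) = v ->
    (quotient_edge e, b) \in ends /\ at_vertex v (quotient_edge e, b).
  by move=> Ee ev; split; [apply: in_ends|rewrite /at_vertex rep_endpoint ev].
have [/hasP[[e0 b0] /allpairsP[[e b] [/= eE _ [e0e b0b]]]]|none] :=
    boolP (has (at_vertex v) ends); last first.
  exists v => //; apply: sub_finite_set (finite_set1 v) => u.
  elim=> // e b _ ev Ee; exfalso.
  have [|h ah] := @endP e b Ee; first by rewrite ev rV.
  by move/hasPn: none => /(_ _ h); rewrite ah.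
move: eE; rewrite -{}e0e {b0b e b} => e0E ae0.
have unique e b : lifted E e -> rep (endpoint e b) = v -> quotient_edge e = e0 /\ b = b0.
  move=> Ee ev; have [h ah] := endP _ _ Ee ev.
  by have [] := count_le1_inj uends cv h (in_ends _ b0 e0E) ah ae0.
have V'E e b : e \in rem e0 E -> rep (endpoint e b) \in rem v V.
  rewrite (mem_rem_uniq _ uE) !inE => /andP[ne eE].
  rewrite (mem_rem_uniq _ uV) inE VE // andbT; apply: contra ne => /eqP ev.
  by have [|<- _] := unique e b _ ev; rewrite /lifted ?qE.
have [|||||||v' v'V fin] := IH (rem e0 E) (rem v V).
- by rewrite size_rem // prednK //; case: (V) vV.
- exact: rem_uniq.
- exact: rem_uniq.
- by move=> e /mem_rem; apply: qE.
- by move=> u /mem_rem; apply: rV.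
- exact: V'E.
- have E0 : (0 < size E)%N by case: (E) e0E.
  by rewrite !size_rem //; move: E0 EV; case: (size E) => // m _; case: (size V).
exists v'; first exact: mem_rem v'V.
have rep_comp u : component (rem e0 E) v' u -> rep u \in rem v V.
  case=> [|e b _ Ee]; first by rewrite rV // (mem_rem v'V).
  by rewrite -rep_endpoint; apply: V'E.
(* Leaving the pruned component means crossing a lift of [e0] to a vertex over [v], where the only
   way on is back through the same edge. So the new vertices are one step away. *)
have closure u : component E v' u -> component (rem e0 E) v' u \/
    exists e, [/\ quotient_edge e = e0, u = endpoint e b0
      & component (rem e0 E) v' (endpoint e (~~ b0))].
  elim=> [|e b _ IHu Ee]; first by left; apply: reach_refl.
  case: IHu => [h|[e' [e'0 ee' h]]].
    have [e0q|ne] := eqVneq (quotient_edge e) e0; last first.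
      by left; apply: reach_step => //; rewrite /lifted (mem_rem_uniq _ uE) !inE ne.
    right; exists e; have [bb0|bb0] := eqVneq b b0.
      have := rep_comp _ h; rewrite (mem_rem_uniq _ uV) bb0 -rep_endpoint e0q.
      by rewrite inE (eqP (ae0 : rep (endpoint e0 b0) == v)) eqxx.
    have e1 : ~~ b = b0 by case: (b) (b0) bb0 => [] [].
    by rewrite -e1 negbK.
  have rev : rep (endpoint e b) = v by rewrite ee' -rep_endpoint e'0; apply/eqP.
  have [e0q bb0] := unique _ _ Ee rev; left; rewrite bb0 in ee' *.
  suff -> : e = e' by [].
  have e2 : e.2 = e'.2 by rewrite -[e.2]/(quotient_edge e).2 e0q -e'0.
  case: e e' e2 ee' {h Ee rev e0q e'0} => [f x] [f' x'] /= <-.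
  by rewrite /endpoint; case: (b0) => /= [/mulIg|] ->.
pose cross u := if b0 then u * e0.2 else u / e0.2.
apply: (@sub_finite_set _ _ (component (rem e0 E) v' `|` cross @` component (rem e0 E) v')).
  move=> u /closure[|[e [e'0 -> h]]]; [by left|right].
  exists (endpoint e (~~ b0)) => //; rewrite /cross -e'0 /endpoint.
  by case: (b0); rewrite //= mulgK.
by rewrite finite_setU; split=> //; apply: finite_image.
Qed.

Section Order.
Variables (L : seq F) (lt : rel (F * F)).
Hypotheses (lt_irr : irreflexive lt) (lt_trans : transitive lt).
Hypothesis lt_translate : forall g e e', lt (translate g e) (translate g e') = lt e e'.
Hypothesis lt_total : forall e e', e.2 \in L -> e'.2 \in L -> e <> e' ->
  lt e e' || lt e' e.

Definition side E e b : set F :=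
  [set v | reach (fun e' => lifted E e' /\ lt e' e) (endpoint e b) v].

Definition essential E e := forall b, infinite_set (side E e b).

Lemma side_translate E e b g v : G g ->
  side E e b v -> side E (translate g e) b (g * v).
Proof.
rewrite /side /= endpoint_translate => Gg; apply: reach_translate => e' [Ee' lt'].
by rewrite lifted_translate // lt_translate.
Qed.

Lemma finite_side_translate E e b g : G g ->
  finite_set (side E e b) -> finite_set (side E (translate g e) b).
Proof.
move=> Gg /(finite_image (fun v => g * v)); apply: sub_finite_set => v sv.
exists (g^-1 * v); last by rewrite mulVKg.
by rewrite -[e](translateK g); apply: side_translate => //; apply: subgroupV.
Qed.

Lemma essential_translate E e g : G g ->
  essential E e -> essential E (translate g e).
Proof.
move=> Gg ess b fin; apply: (ess b).
by rewrite -[e](translateK g); apply: finite_side_translate => //; apply: subgroupV.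
Qed.

Lemma side_closed E e b e' c : lifted E e' -> lt e' e ->
  side E e b (endpoint e' c) -> side E e b (endpoint e' (~~ c)).
Proof. by move=> Ee' lt' h; apply: reach_step. Qed.

Variables (E : seq (F * F)) (V : seq F).
Hypotheses (uE : uniq E) (qE : {in E, forall e, quotient_edge e = e}).
Hypothesis (LE : {in E, forall e, e.2 \in L}).
Hypothesis (VE : forall e b, e \in E -> rep (endpoint e b) \in V).

Let liftedL e : lifted E e -> e.2 \in L.
Proof. by move/LE. Qed.

Definition essential_edges := [seq e <- E | `[< essential E e >]].

(** * Every inessential edge pays for a vertex *)

Section Upper.
(** Acyclicity of the lift, in the form used below: the largest edge of a cycle would violate it. *)
Hypothesis forest : forall e, lifted E e -> ~ side E e false (endpoint e true).

Let inessential := [seq e <- E | ~~ `[< essential E e >]].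

Let forest' e b : lifted E e -> ~ side E e b (endpoint e (~~ b)).
Proof. by case: b => [Ee /reach_sym|]; apply: forest. Qed.

Let dir e := `[< finite_set (side E e true) >].

Let dirP e : e \in inessential -> finite_set (side E e (dir e)).
Proof.
rewrite mem_filter => /andP[/asboolPn/existsNP[b /contrapT fin] _].
rewrite /dir; case: asboolP => // nfin; case: b fin => // /nfin.
Qed.

(** The chosen finite side, when the edge is inessential. Reading [dir] off the quotient edge makes
    the choice invariant under [G]. *)
Let cluster e := side E e (dir (quotient_edge e)).

Let source q v := cluster q v /\ forall e, lifted E e -> lt e q ->
  cluster q (endpoint e false) -> ~ cluster e v.

(* Orient every edge towards its chosen side.  Assign to each vertex of the
   finite tree [cluster q] the largest edge below [q] pointing to it, if any.
   If all vertices got one, the far endpoint of the smallest assigned edge [m]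
   would have got a larger edge [m'], whose cluster contains that of [m]:
   contradiction. *)
Let exists_source q : q \in inessential -> exists v, source q v.
Proof.
move=> Nq; apply: contrapT => no.
have Eq : quotient_edge q = q by apply: qE; move: Nq; rewrite mem_filter => /andP[].
pose inner e := [/\ lifted E e, lt e q & cluster q (endpoint e false)].
have finq : finite_set (cluster q) by rewrite /cluster Eq; apply: dirP.
have fin_inner : finite_set [set e | inner e].
  apply: (@sub_finite_set _ _ (cluster q `*` [set` L])).
    by case=> f x [Ee _ h]; split=> //; exact: liftedL Ee.
  by apply: finite_setX => //; apply: finite_seq.
have inner_end e b : inner e -> cluster q (endpoint e b).
  by move=> [Ee ltq h]; case: b => //; apply: (side_closed (c := false)).
pose largest v m := [/\ inner m, cluster m v
  & forall m', inner m' -> cluster m' v -> ~~ lt m m'].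
have exl v : cluster q v -> exists m, largest v m.
  move=> qv; have [m [fi mv] fmax] : exists2 m, inner m /\ cluster m v &
      forall m', inner m' /\ cluster m' v -> ~~ lt m m'; last first.
    by exists m; split=> // m' ? ?; apply: fmax; split.
  apply: (@finite_set_minimum _ (fun x y => lt y x) [set m | inner m /\ cluster m v]).
  - exact: lt_irr.
  - by move=> y x z xy yz; apply: lt_trans xy.
  - by apply: sub_finite_set fin_inner => m [].
  apply: contrapT => em; apply: no; exists v; split=> // e Ee ltq h ev.
  by apply: em; exists e; split.
have [||m [v qv [fi mv fmax]] fmin] := @finite_set_minimum _ lt
    [set m | exists2 v, cluster q v & largest v m] lt_irr lt_trans.
- by apply: sub_finite_set fin_inner => m [v _ []].
- have [|m hf] := exl (endpoint q (dir (quotient_edge q))); first exact: reach_refl.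
  by exists m; exists (endpoint q (dir (quotient_edge q))) => //; exact: reach_refl.
have [Ef _ _] := fi; set d := dir (quotient_edge m).
have [m' [fi' fw fmax']] := exl _ (inner_end m (~~ d) fi).
have ff' : lt m m'.
  have /orP[//|h] : lt m m' || lt m' m.
    have [Ef' _ _] := fi'; apply: lt_total; [exact: liftedL|exact: liftedL|] => e.
    by move: fw; rewrite -e; apply: forest'.
  have := fmin m' (ex_intro2 _ _ _ (inner_end m (~~ d) fi) (And3 fi' fw fmax')).
  by rewrite h.
have := fmax m' fi'; rewrite ff' => /(_ _)/negP; apply => //.
have h : cluster m' (endpoint m d) by rewrite -(negbK d); apply: side_closed.
apply: reach_trans h _; apply: reach_sub mv => e [Ee lte]; split=> //.
exact: lt_trans ff'.
Qed.

(** Sending an inessential edge to the orbit of a source of its cluster is injective. If two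
    clusters, after translation, had the same source, the smaller edge would lie in the cluster of
    the larger one and point to that source. *)
Theorem size_edges_le : (size E <= size V + size essential_edges)%N.
Proof.
have -> : size E = (size inessential + size essential_edges)%N.
  by rewrite !size_filter addnC count_predC.
rewrite leq_add2r.
have : forall q, exists v, q \in inessential -> source q v.
  move=> q; have [/exists_source[v]|_] := boolP (q \in inessential); first by exists v.
  by exists 1.
move/choice => [s hs].
have NE q : q \in inessential -> q \in E by rewrite mem_filter => /andP[].
have key q1 q2 g : q1 \in inessential -> q2 \in inessential -> G g ->
    s q2 = g * s q1 -> ~ lt (translate g q1) q2.
  move=> N1 N2 Gg e lt12; have [c1 _] := hs _ N1; have [c2 h2] := hs _ N2.
  have E1 : lifted E (translate g q1) by rewrite lifted_translate // /lifted qE ?NE.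
  have c1' : cluster (translate g q1) (s q2).
    by rewrite /cluster quotient_edge_translate // e; apply: side_translate.
  apply: (h2 _ E1 lt12) => //.
  suff h : cluster q2 (endpoint (translate g q1) (dir (quotient_edge (translate g q1)))).
    by move: h; case: dir => // h; apply: (side_closed (c := true)).
  apply: reach_trans c2 _; apply: reach_sym; apply: reach_sub c1' => e' [? lt'].
  by split=> //; apply: lt_trans lt12.
rewrite -(size_map (fun q => rep (s q))); apply: uniq_leq_size; last first.
  move=> _ /mapP[q Nq ->]; have [+ _] := hs _ Nq; rewrite /cluster /side /=.
  elim=> [|e b _ _ [Ee _]]; first exact/VE/NE.
  by rewrite -rep_endpoint; apply: VE.
rewrite map_inj_in_uniq ?filter_uniq // => q1 q2 N1 N2 /rep_inj Gs.
have e21 : s q2 = (s q1 / s q2)^-1 * s q1 by rewrite invgF mulgVK.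
have e12 : s q1 = (s q1 / s q2) * s q2 by rewrite mulgVK.
have Gs' := subgroupV hG Gs.
have [/(congr1 quotient_edge)|ne] := pselect (translate (s q1 / s q2)^-1 q1 = q2).
  by rewrite quotient_edge_translate // !qE ?NE.
have /orP[h|h] :=
  lt_total (e := translate (s q1 / s q2)^-1 q1) (LE (NE _ N1)) (LE (NE _ N2)) ne.
  by case: (key _ _ _ N1 N2 Gs' e21 h).
case: (key _ _ _ N2 N1 Gs e12); rewrite -(lt_translate (s q1 / s q2)^-1).
by rewrite translateK.
Qed.

End Upper.

(** * Deleting essential edges leaves no finite component *)

Section Lower.
Hypotheses (uV : uniq V) (rV : {in V, forall v, rep v = v}).
Hypothesis conn : forall v m, v \in V -> m \in E ->
  exists2 e, quotient_edge e = m & reach (lifted E) v (endpoint e false).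

(* Otherwise some component of the graph without its essential edges is
   finite; its smallest boundary edge has a finite side. *)
Theorem size_essential_edges_le : essential_edges != [::] ->
  (size essential_edges + size V <= size E)%N.
Proof.
move=> nz; pose E' := [seq e <- E | ~~ `[< essential E e >]].
have -> : size E = (size essential_edges + size E')%N.
  by rewrite !size_filter count_predC.
rewrite leq_add2l leqNgt; apply/negP => lt'.
have E'E e : e \in E' -> e \in E by rewrite mem_filter => /andP[].
have [|||v vV fin] := exists_finite_component (E := E') uV _ _ rV _ lt'.
- exact: filter_uniq.
- by move=> e /E'E; apply: qE.
- by move=> e b /E'E; apply: VE.
pose boundary e := quotient_edge e \in essential_edges /\
  exists b, component E' v (endpoint e b).
have ME e : e \in essential_edges -> e \in E by rewrite mem_filter => /andP[].
have step e b : lifted E e -> component E' v (endpoint e b) -> ~ boundary e ->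
    component E' v (endpoint e (~~ b)).
  move=> Ee ev nb; apply: reach_step => //; rewrite /lifted mem_filter Ee andbT.
  apply/negP => ess; apply: nb; split; last by exists b.
  by rewrite mem_filter ess.
have fin_boundary : finite_set [set e | boundary e].
  pose A := component E' v `*` [set` L].
  have finA : finite_set A by apply: finite_setX => //; apply: finite_seq.
  apply: (@sub_finite_set _ _ (A `|` (fun p => (p.1 / p.2, p.2)) @` A)); last first.
    by rewrite finite_setU; split=> //; apply: finite_image.
  move=> [f x] [/ME/liftedL Lx [[] h]]; last by left.
  by right; exists (f * x, x); rewrite //= mulgK.
have ex_boundary : [set e | boundary e] !=set0.
  apply: contrapT => em; have nb e : ~ boundary e by move=> be; apply: em; exists e.
  have closed u : reach (lifted E) v u -> component E' v u.
    by elim=> [|e b _ h Ee]; [apply: reach_refl|apply: step].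
  have [m mM] : exists m, m \in essential_edges.
    by case: essential_edges nz => // m M _; exists m; apply: mem_head.
  have [e em' /closed h] := conn vV (ME m mM).
  by apply: (nb e); split; [rewrite em'|exists false].
have [e [Me [b hb]] emin] :=
  finite_set_minimum lt_irr lt_trans fin_boundary ex_boundary.
have ess : essential E e.
  have := Me; rewrite mem_filter quotient_edgeE => /andP[/asboolP ess _].
  rewrite -[e](translateK (rep e.1 / e.1)); apply: essential_translate => //.
  exact: subgroupV.
(* Within its side at [b], the edge [e] stays in the finite component: to leave it takes a boundary
   edge below [e], against minimality. *)
apply: (ess b); apply: sub_finite_set fin => u.
elim=> // e' c _ h [Ee' lt'e]; apply: step => // be'.
by have := emin e' be'; rewrite lt'e.
Qed.

End Lower.
End Order.
End Quotient.
End LabelledGraph.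

(** * Ranks of subgroups and edge counts *)

Section CycleRank.
Variables (F : groupType) (G : set F) (rep : F -> F).
Hypotheses (hG : subgroup G) (rep_in : forall f, G (rep f / f)).
Hypothesis rep_eq : forall f g, G (f / g) -> rep f = rep g.
Hypothesis rep1 : rep 1 = 1.
Variables (E : seq (F * F)) (V : seq F).
Hypotheses (uE : uniq E) (qE : {in E, forall e, quotient_edge rep e = e}).
Hypotheses (uV : uniq V) (V1 : 1 \in V).
Hypothesis VE : forall e b, e \in E -> rep (endpoint e b) \in V.

Let V0 := rem 1 V.

Let size_V : size V = (size V0).+1.
Proof. by rewrite /V0 size_rem // prednK //; case: (V) V1. Qed.

Let uV0 : uniq V0.
Proof. exact: rem_uniq. Qed.

(* An injection: a Z/2-valued homomorphism on G, prescribed on [bs], together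
   with a function on the vertices vanishing at the base point determines a
   cochain on the edges. *)
Lemma size_basis_le B (bs : seq F) : free_basis G B ->
  uniq bs -> [set` bs] `<=` B ->
  {in bs, forall x, reach (lifted rep E) 1 x} ->
  {in V, forall v, exists2 h, rep h = v & reach (lifted rep E) 1 h} ->
  (size bs + size V <= (size E).+1)%N.
Proof.
move=> hB ubs bsB bs_reach V_reach.
rewrite size_V addnS ltnS -(card_seq_sub ubs) -(card_seq_sub uV0) -card_sum.
rewrite -(card_seq_sub uE).
pose A := (seq_sub bs + seq_sub V0)%type.
pose on_bs (d : {ffun A -> bool}) x := oapp (fun u => d (inl u)) false (insub x).
pose on_V (d : {ffun A -> bool}) x := oapp (fun u => d (inr u)) false (insub x).
have /choice[chi hchi] d := free_basis_hom d hB.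
pose psi d := chi (on_bs d).
have hpsi d : (forall f g, G f -> G g -> psi d (f * g) = psi d f (+) psi d g) /\
    (forall x, B x -> psi d x = on_bs d x) by apply: hchi.
have G_in h : G (h / rep h) by rewrite -invgF; apply: subgroupV.
(* A function on the lift that changes by the constant [psi d g] under [g] in [G]; hence its
   coboundary [eta] descends to the quotient edges. *)
pose theta d h := psi d (h / rep h) (+) on_V d (rep h).
pose eta d (e : F * F) := theta d (e.1 * e.2) (+) theta d e.1.
have psi1 d : psi d 1 = false.
  have := (hpsi d).1 1 1 (subgroup1 hG) (subgroup1 hG).
  by rewrite mulg1; case: (psi d 1).
have etaE d e : eta d (quotient_edge rep e) = eta d e.
  rewrite quotient_edgeE; move: (rep e.1 / e.1) (rep_in e.1) => g Gg.
  suff th h : theta d (g * h) = psi d g (+) theta d h.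
    rewrite /eta /= -mulgA !th.
    by move: (psi d g) (theta d (e.1 * e.2)) (theta d e.1) => [] [] [].
  by rewrite /theta (rep_mul rep_eq h Gg) -mulgA ((hpsi d).1 g (h / rep h)) // addbA.
have theta_step d e b : theta d (endpoint e (~~ b)) =
    theta d (endpoint e b) (+) eta d (quotient_edge rep e).
  rewrite etaE /eta /endpoint; case: b => /=; first by rewrite addKb.
  by rewrite addbC addbK.
apply: (@leq_card_ffun_bool _ _ (fun d => [ffun e : seq_sub E => eta d (val e)])).
move=> d d' eq_eta.
have onV1 D : on_V D 1 = false.
  by rewrite /on_V insubF // /V0 (mem_rem_uniq _ uV) inE eqxx.
have th h : reach (lifted rep E) 1 h -> theta d h = theta d' h.
  elim=> [|e b _ IH Ee]; first by rewrite /theta rep1 divg1 !psi1 !onV1.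
  rewrite !theta_step IH; congr (_ (+) _).
  by move/ffunP: eq_eta => /(_ (SeqSub Ee)); rewrite !ffunE.
have eq_bs x : x \in bs -> on_bs d x = on_bs d' x.
  move=> xbs; have Bx := bsB _ xbs; rewrite -(hpsi d).2 // -(hpsi d').2 //.
  have Gx : G x by case: hB => <- _; apply: sub_generated.
  have rx : rep x = 1 by rewrite -[RHS]rep1; apply: rep_eq; rewrite divg1.
  by have := th _ (bs_reach _ xbs); rewrite /theta rx divg1 !onV1 !addbF.
have psi_eq : psi d = psi d'.
  congr chi; apply/funext => x; have [/eq_bs//|xbs] := boolP (x \in bs).
  by rewrite /on_bs insubF //; apply/negbTE.
apply/ffunP => -[[x xbs]|[v v0]].
  have := eq_bs x xbs; rewrite /on_bs; case: insubP => [u _ ux|]; last by rewrite xbs.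
  by have -> : u = SeqSub xbs by apply: val_inj.
have [h hv /th] := V_reach v (mem_rem v0).
rewrite /theta psi_eq hv => /addbI; rewrite /on_V.
case: insubP => [u _ uv|]; last by rewrite v0.
by have -> : u = SeqSub v0 by apply: val_inj.
Qed.

(* A cochain on the edges is determined by its values on the loops [gs] and by
   its potential at the vertices, which vanishes at the base point. *)
Lemma size_edges_lt_generators X (gs : seq F) :
  free_basis [set: F] X -> {in E, forall e, X e.2} ->
  G = generated [set` gs] -> (size E < size gs + size V)%N.
Proof.
move=> hX XE Ggs.
rewrite size_V addnS ltnS -(card_seq_sub uV0) -(card_seq_sub uE).
rewrite -[size gs]card_ord -card_sum.
(* The pullback of [d] to the Cayley graph of [F], extended by 0 to the edges outside the lift of
   [E]. *)
pose c (d : {ffun seq_sub E -> bool}) f x :=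
  oapp d false (insub (quotient_edge rep (f, x))).
have /choice[phi hphi] d := exists_potential (c d) hX.
have gX : generated X = [set: F] by case: hX.
have phiM d g f : G g -> phi d (g * f) = phi d g (+) phi d f.
  move=> Gg; apply: (@potential_translate _ X (c d)); rewrite ?gX // => h x _ _.
  by rewrite /c -[(g * h, x)]/(translate g (h, x)) (quotient_edge_translate rep_eq).
have phi1 d : phi d 1 = false by case: (hphi d).
apply: (@leq_card_ffun_bool _ _ (fun d => [ffun s : 'I_(size gs) + seq_sub V0 =>
  match s with inl i => phi d (nth 1 gs i) | inr v => phi d (val v) end])).
move=> d d' /ffunP eq_m.
have eqV v : v \in V -> phi d v = phi d' v.
  have [->|v1] := eqVneq v 1; first by rewrite !phi1.
  move=> vV; have v0 : v \in V0 by rewrite /V0 (mem_rem_uniq _ uV) inE v1.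
  by have := eq_m (inr (SeqSub v0)); rewrite !ffunE.
have eqgs x : x \in gs -> phi d x = phi d' x.
  rewrite -index_mem => ltx; have := eq_m (inl (Ordinal ltx)).
  by rewrite !ffunE /= nth_index // -index_mem.
have phiV D x : G x -> phi D x^-1 = phi D x.
  by move=> Gx; have := phiM D x x^-1 Gx; rewrite mulgV phi1; do 2 case: (phi D _).
have eqG : forall g, G g -> phi d g = phi d' g.
  rewrite Ggs; apply: generated_ind; first by rewrite !phi1.
  move=> f [x b] Gf eqf xgs; rewrite -Ggs in Gf.
  have Gx : G x by rewrite Ggs; apply: sub_generated.
  rewrite !phiM // eqf /letter_val; congr (_ (+) _).
  by case: b xgs => /= /eqgs; rewrite ?phiV.
apply/ffunP => -[e eE]; have qe := qE eE.
have cE D : c D e.1 e.2 = D (SeqSub eE).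
  rewrite /c -surjective_pairing qe; case: insubP => [u _ ue|]; last by rewrite eE.
  by rewrite /=; congr (D _); apply: val_inj.
have cphi D : c D e.1 e.2 = phi D (e.1 * e.2) (+) phi D e.1.
  have [_ step] := hphi D; rewrite (step e.1 e.2 I (XE e eE)).
  by case: (phi D e.1) (c D _ _) => [] [].
rewrite -(cE d) -(cE d') !cphi; congr (_ (+) _); last first.
  by apply: eqV; rewrite -[in e.1]qe /=; apply: (VE false eE).
(* The head of [e] is moved to its representative by an element of [G], where the two potentials
   already agree. *)
have Gr h : G (h / rep h) by rewrite -invgF; apply: subgroupV.
rewrite -[e.1 * e.2](mulgVK (rep (e.1 * e.2))) !(phiM _ _ _ (Gr _)) (eqG _ (Gr _)).
by rewrite (eqV (rep _)) //; apply: (VE true eE).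
Qed.

End CycleRank.

(** * Paths in the Cayley tree *)

Section Paths.
Variable F : groupType.
Implicit Types (e : F * F) (f g h : F) (w : seq (F * bool)) (l k : F * bool).

(** An inverse letter crosses its edge from head to tail, so [l.2] tells which end of the edge lies
    at [f]. *)
Definition edge_at f l : F * F := (if l.2 then f * letter_val l else f, l.1).

Fixpoint path_edges f w : seq (F * F) :=
  if w is l :: w' then edge_at f l :: path_edges (f * letter_val l) w' else [::].

Lemma endpoint_edge_at f l : endpoint (edge_at f l) l.2 = f.
Proof. by case: l => x []; rewrite /endpoint /edge_at /letter_val //= mulgVK. Qed.

Lemma endpoint_edge_atN f l : endpoint (edge_at f l) (~~ l.2) = f * letter_val l.
Proof. by case: l => x []. Qed.

Lemma path_edges_cat f w1 w2 :
  path_edges f (w1 ++ w2) = path_edges f w1 ++ path_edges (f * word_val w1) w2.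
Proof.
elim: w1 f => [|l w1 IH] f /=; first by rewrite word_val_nil mulg1.
by rewrite IH word_val_cons mulgA.
Qed.

Lemma path_edges_split f w e : e \in path_edges f w ->
  exists w1 l w2, w = w1 ++ l :: w2 /\ e = edge_at (f * word_val w1) l.
Proof.
elim: w f => //= l w IH f; rewrite inE => /orP[/eqP->|/IH[w1 [k [w2 [-> ->]]]]].
  by exists [::], l, w; rewrite word_val_nil mulg1.
by exists (l :: w1), k, w2; rewrite word_val_cons mulgA.
Qed.

Lemma reach_path (Q : F * F -> Prop) f w :
  {in path_edges f w, forall e, Q e} -> reach Q f (f * word_val w).
Proof.
elim: w f => [|l w IH] f hQ; first by rewrite word_val_nil mulg1; apply: reach_refl.
rewrite word_val_cons mulgA; apply: (@reach_trans _ _ _ (f * letter_val l)).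
  rewrite -endpoint_edge_atN; apply: reach_step; last by apply: hQ; apply: mem_head.
  by rewrite endpoint_edge_at; apply: reach_refl.
by apply: IH => e ew; apply: hQ; rewrite inE ew orbT.
Qed.

Lemma reach_path_endpoint f w e b : e \in path_edges f w ->
  reach (fun e => e \in path_edges f w) f (endpoint e b).
Proof.
move=> ew; have [w1 [l [w2 [ew12 el]]]] := path_edges_split ew.
have h : reach (fun e => e \in path_edges f w) f (endpoint e l.2).
  rewrite el endpoint_edge_at; apply: reach_path => e' e'1.
  by rewrite ew12 path_edges_cat mem_cat e'1.
have [->//|bl] := eqVneq b l.2.
have -> : b = ~~ l.2 by case: (b) (l.2) bl => [] [].
exact: reach_step.
Qed.

Lemma path_edges_letter (S : set F) f w e :
  word_over S w -> e \in path_edges f w -> S e.2.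
Proof.
move=> Sw /path_edges_split[w1 [l [w2 [ew ->]]]].
by apply: Sw; rewrite ew mem_cat inE eqxx orbT.
Qed.

Section FreePaths.
Variables (K B : set F).
Hypothesis hB : free_basis K B.

(** Crossing an edge twice in the same direction gives a nonempty reduced word with value 1. In
    opposite directions the word in between has value 1, so it is empty and two adjacent letters
    cancel. *)
Lemma uniq_path_edges f w :
  word_over B w -> reduced w -> uniq (path_edges f w).
Proof.
have [_ free] := hB.
elim: w f => // l w IH f Bw rw; have [Bl Bw'] := (word_over_cons _ _ _).1 Bw.
rewrite /= IH // ?(reduced_behead rw) // andbT; apply/negP.
case/path_edges_split => w1 [k [w2 [ew e]]].
have kl : k.1 = l.1 by rewrite -[LHS]/(edge_at (f * letter_val l * word_val w1) k).2 -e.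
have [k2|k2] := eqVneq k.2 l.2.
  have /eqP := congr1 (fun e => endpoint e l.2) e.
  rewrite endpoint_edge_at -k2 endpoint_edge_at -mulgA -word_val_cons.
  move=> /eqP/esym fw; have w1' : word_val (l :: w1) = 1.
    by apply: (mulgI f); rewrite mulg1.
  move: Bw rw; rewrite ew -cat_cons => /word_over_cat[Bw1 _] /reduced_catl rw1.
  by have := free _ Bw1 rw1 isT; rewrite w1' eqxx.
have kN : k.2 = ~~ l.2 by case: (k.2) (l.2) k2 => [] [].
have := congr1 (fun e => endpoint e k.2) e.
rewrite endpoint_edge_at kN endpoint_edge_atN => /esym fw.
have w11 : word_val w1 = 1 by apply: (mulgI (f * letter_val l)); rewrite mulg1.
case: w1 ew w11 {e fw} => [|k' w1] ew w11.
  move: rw; rewrite ew reduced_cons2 => /andP[/eqP + _]; apply.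
  by rewrite [k]surjective_pairing kl kN.
move: Bw' (reduced_behead rw); rewrite ew => /word_over_cat[Bw1 _] /reduced_catl rw1.
by have := free _ Bw1 rw1 isT; rewrite w11 eqxx.
Qed.

(** The largest edge is crossed only once, so the path before it and the path after it consist of
    smaller edges. *)
Lemma leading_edge (lt : rel (F * F)) w :
  irreflexive lt -> transitive lt ->
  (forall e e', B e.2 -> B e'.2 -> e <> e' -> lt e e' || lt e' e) ->
  word_over B w -> reduced w -> w != [::] ->
  let Q e e' := e' \in path_edges 1 w /\ lt e' e in
  exists e b, [/\ e \in path_edges 1 w,
    forall e', e' \in path_edges 1 w -> e' <> e -> lt e' e,
    reach (Q e) 1 (endpoint e b) & reach (Q e) (endpoint e (~~ b)) (word_val w)].
Proof.
move=> irr tr tot Bw rw nz Q.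
have [||||e ew emax] := @finite_set_minimum _ (fun x y => lt y x) [set` path_edges 1 w].
- exact: irr.
- by move=> y x z xy yz; apply: tr xy.
- exact: finite_seq.
- by case: (w) nz => // l w' _; exists (edge_at 1 l); apply: mem_head.
have {}emax e' : e' \in path_edges 1 w -> e' <> e -> lt e' e.
  move=> e'w ne; have /orP[//|h] :=
    tot e' e (path_edges_letter Bw e'w) (path_edges_letter Bw ew) ne.
  by have := emax e' e'w; rewrite h.
have [w1 [l [w2 [w12 el]]]] := path_edges_split ew.
rewrite mul1g in el.
have [e1 e2] : e \notin path_edges 1 w1 /\
    e \notin path_edges (word_val w1 * letter_val l) w2.
  have := uniq_path_edges 1 Bw rw.
  rewrite w12 path_edges_cat /= mul1g cat_uniq /= -el => /and3P[_ + /andP[e2 _]].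
  by rewrite negb_or => /andP[e1 _].
exists e, l.2; split; [exact: ew|exact: emax| |].
  have -> : endpoint e l.2 = 1 * word_val w1 by rewrite el endpoint_edge_at mul1g.
  apply: reach_path => e' e'1.
  have e'w : e' \in path_edges 1 w by rewrite w12 path_edges_cat mem_cat e'1.
  by split=> //; apply: emax => // e'e; rewrite -e'e e'1 in e1.
have -> : endpoint e (~~ l.2) = word_val w1 * letter_val l.
  by rewrite el endpoint_edge_atN.
rewrite [in word_val w]w12 word_val_cat word_val_cons mulgA.
apply: reach_path => e' e'2.
have e'w : e' \in path_edges 1 w.
  by rewrite w12 path_edges_cat mem_cat /= inE mul1g e'2 !orbT.
by split=> //; apply: emax => // e'e; rewrite -e'e e'2 in e2.
Qed.

End FreePaths.

(** The potential of the indicator cochain of [e] changes across [e] and across no other edge. *)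
Lemma tree_bridge X (Q : F * F -> Prop) e b : free_basis [set: F] X -> X e.2 ->
  (forall e', Q e' -> X e'.2 /\ e' <> e) ->
  ~ reach Q (endpoint e b) (endpoint e (~~ b)).
Proof.
move=> hX Xe hQ.
have [phi [_ hphi]] := exists_potential (fun f x => (f, x) == e) hX.
have step e' c : X e'.2 -> phi (endpoint e' (~~ c)) = phi (endpoint e' c) (+) (e' == e).
  move=> Xe'; have := hphi e'.1 e'.2 I Xe'; rewrite -surjective_pairing.
  by rewrite /endpoint; case: c => /= -> //; case: (phi _) (_ == _) => [] [].
have inv f g : reach Q f g -> phi f = phi g.
  elim=> // e' c _ -> /hQ[Xe' /eqP/negPf ne].
  by rewrite step // ne addbF.
by move/inv; rewrite (step e b Xe) eqxx; case: (phi _).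
Qed.

End Paths.

(** * Comparing the two trees *)

Section Comparison.
Variables (F : groupType) (X Y : seq F) (H G : set F).
Hypothesis hX : free_basis [set: F] [set` X].
Hypotheses (hG : subgroup G) (HY : H = generated [set` Y]).
Implicit Types (e : F * F) (f g h u v : F) (b : bool).

Let hH : subgroup H.
Proof. by rewrite HY; apply: generated_subgroup. Qed.

Let K := H `&` G.

Let hK : subgroup K.
Proof. exact: subgroupI. Qed.

Variables (repG repK : F -> F).
Hypotheses (repG_in : forall f, G (repG f / f))
  (repG_eq : forall f g, G (f / g) -> repG f = repG g) (repG1 : repG 1 = 1).
Hypotheses (repK_in : forall f, K (repK f / f))
  (repK_eq : forall f g, K (f / g) -> repK f = repK g) (repK1 : repK 1 = 1).

Variable lt : rel (F * F).
Hypotheses (lt_irr : irreflexive lt) (lt_trans : transitive lt).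
Hypothesis lt_translate : forall g e e', lt (translate g e) (translate g e') = lt e e'.
Hypothesis lt_total : forall e e', e.2 \in X -> e'.2 \in X -> e <> e' ->
  lt e e' || lt e' e.

(* Along the path [pe h] from 1 to [h] the edge [ld h] is crossed once and is
   larger than all others. *)
Variables (pe : F -> seq (F * F)) (ld : F -> F * F) (bd : F -> bool).
Hypothesis ld_pe : {in Y, forall h, ld h \in pe h}.
Hypothesis pe_X : forall h e, h \in Y -> e \in pe h -> e.2 \in X.
Hypothesis pe_reach : forall h e b, h \in Y -> e \in pe h ->
  reach (fun e' => e' \in pe h) 1 (endpoint e b).
Let before h e := e \in pe h /\ lt e (ld h).
Hypothesis reach_ld : {in Y, forall h, reach (before h) 1 (endpoint (ld h) (bd h))}.
Hypothesis ld_reach : {in Y, forall h, reach (before h) (endpoint (ld h) (~~ bd h)) h}.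
Hypothesis ld_inj : {in Y &, injective (fun h => (ld h).2)}.

Definition leading e : F * F := translate e.1 (ld e.2).

Definition leading_lt e e' : bool := lt (leading e) (leading e').

Let leading_translate g e : leading (translate g e) = translate g (leading e).
Proof. by rewrite /leading translateM. Qed.

Let leading_inj e e' : e.2 \in Y -> e'.2 \in Y ->
  (leading e).2 = (leading e').2 -> e.2 = e'.2.
Proof. exact: ld_inj. Qed.

Let llt_total e e' : e.2 \in Y -> e'.2 \in Y -> e <> e' ->
  leading_lt e e' || leading_lt e' e.
Proof.
move=> Ye Ye' ne; apply: lt_total; try by apply: pe_X (ld_pe _).
move=> ee'; have e2 := leading_inj Ye Ye' (congr1 snd ee').
apply: ne; case: e e' e2 ee' {Ye Ye'} => [f x] [f' x'] /= <-.
by move/(congr1 fst) => /= /mulIg->.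
Qed.

Section Graphs.
Variable E : seq (F * F).
Hypotheses (uE : uniq E) (qE : {in E, forall e, quotient_edge repK e = e}).
Hypotheses (EY : {in E, forall e, e.2 \in Y}) (EH : {in E, forall e, H e.1}).
Hypothesis E_reach : {in E, forall q, exists2 e, quotient_edge repK e = q &
  reach (lifted repK E) 1 e.1}.

Definition image_edges : seq (F * F) :=
  undup [seq quotient_edge repG (translate q.1 e) | q <- E, e <- pe q.2].

Definition vertices_of (rep : F -> F) (D : seq (F * F)) : seq F :=
  undup (1 :: [seq rep (endpoint e b) | e <- D, b <- [:: false; true]]).

Let E' := image_edges.
Let V := vertices_of repK E.
Let V' := vertices_of repG E'.

Lemma mem_vertices_of rep D v : v \in vertices_of rep D ->
  v = 1 \/ exists e b, e \in D /\ v = rep (endpoint e b).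
Proof.
rewrite mem_undup inE => /orP[/eqP|]; first by left.
by case/allpairsP => -[e b] [/= De _ ->]; right; exists e, b.
Qed.

Lemma vertices_of_mem rep D e b : e \in D -> rep (endpoint e b) \in vertices_of rep D.
Proof.
move=> De; rewrite mem_undup inE; apply/orP; right.
by apply/allpairsP; exists (e, b); split=> //; case: b.
Qed.

Let liftedY e : lifted repK E e -> e.2 \in Y.
Proof. by move/EY. Qed.

Let lifted_image e e' : lifted repK E e -> e' \in pe e.2 ->
  lifted repG E' (translate e.1 e').
Proof.
move=> Ee pe'; rewrite /lifted mem_undup; apply/allpairsPdep.
exists (quotient_edge repK e), e'; split=> //=.
rewrite -(quotient_edge_translate repG_eq (translate e.1 e') (repK_in e.1).2).
by rewrite translateM mulgVK.
Qed.

Let lifted_leading e : lifted repK E e -> lifted repG E' (leading e).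
Proof. by move=> Ee; apply: lifted_image => //; apply/ld_pe/liftedY. Qed.

Let below e e' := lifted repG E' e' /\ lt e' (leading e).

Let reach_leading e : lifted repK E e ->
  reach (below e) (endpoint e false) (endpoint (leading e) (bd e.2)).
Proof.
move=> Ee; have := reach_ld (liftedY Ee).
move/(@reach_translate _ _ (below e) e.1); rewrite mulg1 -endpoint_translate; apply.
by move=> e' [pe' lt']; split; [apply: lifted_image|rewrite lt_translate].
Qed.

Let leading_reach e : lifted repK E e ->
  reach (below e) (endpoint (leading e) (~~ bd e.2)) (endpoint e true).
Proof.
move=> Ee; have := ld_reach (liftedY Ee).
move/(@reach_translate _ _ (below e) e.1); rewrite -endpoint_translate; apply.
by move=> e' [pe' lt']; split; [apply: lifted_image|rewrite lt_translate].
Qed.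

Let reach_edge (Q : F * F -> Prop) e b : lifted repK E e ->
  (forall e', below e e' -> Q e') -> Q (leading e) ->
  reach Q (endpoint e b) (endpoint e (~~ b)).
Proof.
move=> Ee QQ Ql; suff h : reach Q (endpoint e false) (endpoint e true).
  by case: b => //; apply: reach_sym.
apply: reach_trans (reach_sub QQ (reach_leading Ee)) _.
apply: reach_trans _ (reach_sub QQ (leading_reach Ee)).
by apply: reach_step => //; apply: reach_refl.
Qed.

Let reach_image f g : reach (lifted repK E) f g -> reach (lifted repG E') f g.
Proof.
elim=> [|e b _ IH Ee]; first exact: reach_refl.
apply: reach_trans IH _; apply: reach_edge => //; last exact: lifted_leading.
by move=> e' [].
Qed.

Let reach_below e f g :
  reach (fun e' => lifted repK E e' /\ leading_lt e' e) f g -> reach (below e) f g.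
Proof.
elim=> [|e' b _ IH [Ee' lt']]; first exact: reach_refl.
apply: reach_trans IH _; apply: reach_edge => // [e'' [? lt'']|].
  by split=> //; apply: lt_trans lt'.
by split=> //; apply: lifted_leading.
Qed.

Let E'X : {in E', forall e, e.2 \in X}.
Proof.
by move=> e; rewrite mem_undup => /allpairsPdep[q [e' [/EY Yq /(pe_X Yq) ? ->]]].
Qed.

Let qE' : {in E', forall e, quotient_edge repG e = e}.
Proof.
move=> e; rewrite mem_undup => /allpairsPdep[q [e' [_ _ ->]]] /=.
by rewrite /quotient_edge /= (rep_rep repG_in repG_eq).
Qed.

(** Replacing smaller edges by their paths would join the two ends of the leading edge without
    crossing it, which a tree forbids. *)
Let forest e : lifted repK E e ->
  ~ side repK leading_lt E e false (endpoint e true).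
Proof.
move=> Ee /reach_below h.
apply: (@tree_bridge _ _ (below e) (leading e) (bd e.2) hX).
- exact: (E'X (lifted_leading Ee)).
- by move=> e' [/E'X Xe' lt']; split=> // ee'; rewrite ee' lt_irr in lt'.
apply: reach_trans (reach_sym (reach_leading Ee)) _.
by apply: reach_trans h (reach_sym (leading_reach Ee)).
Qed.

Let essential_image e : lifted repK E e ->
  essential repK leading_lt E e -> essential repG lt E' (leading e).
Proof.
move=> Ee ess b; have [->|bN] := eqVneq b (bd e.2).
  apply: sub_infinite_set (ess false) => v /reach_below h.
  exact: reach_trans (reach_sym (reach_leading Ee)) h.
have -> : b = ~~ bd e.2 by case: b (bd e.2) bN => [] [].
apply: sub_infinite_set (ess true) => v /reach_below h.
exact: reach_trans (leading_reach Ee) h.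
Qed.

(** Here [K = H :&: G] enters. Equal images force the same generator and starting points that differ
    by an element of [G]; since both lie in [H], they differ by an element of [K]. *)
Let size_essential_image :
  (size (essential_edges repK leading_lt E) <= size (essential_edges repG lt E'))%N.
Proof.
have sE q : q \in essential_edges repK leading_lt E ->
    essential repK leading_lt E q /\ q \in E.
  by rewrite mem_filter => /andP[/asboolP].
rewrite -(size_map (fun q => quotient_edge repG (leading q))).
apply: uniq_leq_size; last first.
  move=> _ /mapP[q /sE[ess qin] ->]; have Lq : lifted repK E q by rewrite /lifted qE.
  rewrite mem_filter; apply/andP; split; last exact: lifted_leading.
  apply/asboolP; rewrite quotient_edgeE.
  by apply: (essential_translate hG repG_eq) => //; apply: essential_image.
rewrite map_inj_in_uniq; first exact: filter_uniq.
move=> q q' /sE[_ qin] /sE[_ q'in] /[dup] /(congr1 snd)/(leading_inj (EY qin) (EY q'in)) e2.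
move=> /(congr1 fst) /= /(rep_inj hG repG_in); rewrite e2 invgM !mulgA mulgK => Gqq'.
rewrite -[LHS](qE qin) -[RHS](qE q'in) /quotient_edge e2; congr (_, _).
apply: repK_eq; split; last exact: Gqq'.
by apply: (subgroupF hH); apply: EH.
Qed.

Let V_rep rep D : rep 1 = 1 -> (forall f, rep (rep f) = rep f) ->
  {in vertices_of rep D, forall v, rep v = v}.
Proof.
by move=> r1 rr v /mem_vertices_of[->|[e [b [_ ->]]]].
Qed.

(** Makes the image connected modulo [G]: its edges lie on paths belonging to edges of [E], which
    [E_reach] connects to 1 after translation. *)
Let reach_V' v : v \in V' -> exists2 g, G g & reach (lifted repG E') g v.
Proof.
case/mem_vertices_of => [->|[m [b [mE' ->]]]].
  by exists 1; [apply: subgroup1|apply: reach_refl].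
move: mE'; rewrite mem_undup => /allpairsPdep[q [e' [/= qin pe' ->]]].
have [e eq h] := E_reach qin.
have Ee : lifted repK E e by rewrite /lifted eq.
have q2 : q.2 = e.2 by rewrite -eq.
have h1 : reach (lifted repG E') 1 (e.1 * endpoint e' b).
  apply: reach_trans (reach_image h) _; rewrite -[X in reach _ X](mulg1 e.1).
  rewrite q2 in pe'; apply: reach_translate (pe_reach b (liftedY Ee) pe') => e'' pe''.
  exact: lifted_image.
rewrite (rep_endpoint repG_in repG_eq) endpoint_translate.
have <- : repG (e.1 * endpoint e' b) = repG (q.1 * endpoint e' b).
  apply: repG_eq; rewrite invgM !mulgA mulgK -eq /= -invgF.
  exact: subgroupV hG _ (repK_in _).2.
set u := e.1 * _; exists (repG u / u * 1); first by rewrite mulg1.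
rewrite -[X in reach _ _ X](mulgVK u).
apply: reach_translate h1 => e''; rewrite (lifted_translate repG_eq) //.
Qed.

Let conn v m : v \in V' -> m \in E' ->
  exists2 e, quotient_edge repG e = m & reach (lifted repG E') v (endpoint e false).
Proof.
move=> /reach_V'[g Gg gv] mE'; have := vertices_of_mem repG false mE'.
rewrite -/V' /= => /reach_V'[g' Gg' gm].
have Ggg := subgroupF hG Gg Gg'.
have m1 : repG m.1 = m.1 by rewrite -[in RHS](qE' mE').
exists (translate (g / g') m); first by rewrite (quotient_edge_translate repG_eq) // qE'.
apply: reach_trans (reach_sym gv) _; rewrite /= -m1.
rewrite -[X in reach _ X](mulgVK g' g).
by apply: reach_translate gm => e; rewrite (lifted_translate repG_eq).
Qed.

Lemma rank_comparison B (bs gs : seq F) :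
  free_basis K B -> uniq bs -> [set` bs] `<=` B -> G = generated [set` gs] ->
  {in bs, forall x, reach (lifted repK E) 1 x} ->
  {in V, forall v, exists2 h, repK h = v & reach (lifted repK E) 1 h} ->
  (size bs <= size gs)%N.
Proof.
move=> hB ubs bsB Ggs bs_reach V_reach.
have uV : uniq V by apply: undup_uniq.
have uV' : uniq V' by apply: undup_uniq.
have V1 : 1 \in V by rewrite mem_undup mem_head.
have V'1 : 1 \in V' by rewrite mem_undup mem_head.
have rV := V_rep repK1 (rep_rep repK_in repK_eq) : {in V, forall v, repK v = v}.
have rV' := V_rep repG1 (rep_rep repG_in repG_eq) : {in V', forall v, repG v = v}.
have VE e b : e \in E -> repK (endpoint e b) \in V by apply: vertices_of_mem.
have VE' e b : e \in E' -> repG (endpoint e b) \in V' by apply: vertices_of_mem.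
have uE' : uniq E' by apply: undup_uniq.
have h1 := size_basis_le hK repK_in repK_eq repK1 uE uV V1 hB ubs bsB bs_reach V_reach.
have llt_translate g e e' : leading_lt (translate g e) (translate g e') = leading_lt e e'.
  by rewrite /leading_lt !leading_translate lt_translate.
have llt_irr : irreflexive leading_lt by move=> e; apply: lt_irr.
have llt_trans : transitive leading_lt by move=> e1 e2 e3; apply: lt_trans.
have h2 := size_edges_le hK repK_in repK_eq llt_irr llt_trans llt_translate llt_total
  uE qE EY VE forest.
have h3 := size_essential_image.
have h4 := size_edges_lt_generators hG repG_in repG_eq uE' qE' uV' V'1 VE' hX E'X Ggs.
have h6 : (size bs <= (size (essential_edges repG lt E')).+1)%N.
  rewrite -(leq_add2r (size V)) (leq_trans h1) // addSn ltnS addnC.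
  by rewrite (leq_trans h2) // leq_add2l.
have [nil|nz] := eqVneq (essential_edges repG lt E') [::]; last first.
  apply: leq_trans h6 _; rewrite -(ltn_add2r (size V')); apply: leq_ltn_trans h4.
  exact: (size_essential_edges_le hG repG_in repG_eq lt_irr lt_trans lt_translate
    uE' qE' E'X VE' uV' rV' conn nz).
(* Without essential edges only [size bs <= 1] is left. This suffices unless [gs] is empty; then [G]
   and [K] are trivial, whereas a basis element is not 1. *)
rewrite nil /= in h6; case: bs ubs bsB {bs_reach h1} h6 => // b [] // _ bsB _.
case: gs Ggs {h4} => // Gnil; have Bb : B b by apply: bsB; apply: mem_head.
have /eqP[] : b != 1.
  have [_ /(_ [:: (b, false)])] := hB; rewrite word_val_cons word_val_nil mulg1; apply=> //.
  by move=> l; rewrite inE => /eqP->.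
have : K b by case: hB => <- _; apply: sub_generated.
case=> _; rewrite Gnil => /generatedP[[|l w] Sw <-]; first by rewrite word_val_nil.
by have := Sw l (mem_head _ _).
Qed.

End Graphs.
End Comparison.

(** * Subgroups with generators at distinct levels *)

Section EchelonGenerators.
Variables (F : groupType) (X : seq F).
Hypothesis hX : free_basis [set: F] [set` X].
Implicit Types (e : F * F) (f g h : F).

(** Levels count from 0: level [i] means that the largest basis letter in the normal form of [h] is
    the one of index [i] in [X]. *)
Definition has_level h i :=
  [/\ (i < size X)%N, generated [set` take i.+1 X] h
    & ~ generated [set` take i X] h].

Lemma take_generatedS i j : (i <= j)%N ->
  generated [set` take i X] `<=` generated [set` take j X].
Proof.
move=> ij; apply: generatedS => x /=; rewrite -(minn_idPl ij) take_min.
exact: mem_take.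
Qed.

Lemma has_level_inj h i j : has_level h i -> has_level h j -> i = j.
Proof.
move=> [_ hi ni] [_ hj nj]; apply/eqP; rewrite eqn_leq.
by apply/andP; split; rewrite leqNgt; apply/negP => lt;
  [apply: ni; apply: take_generatedS hj|apply: nj; apply: take_generatedS hi].
Qed.

Lemma exists_edge_order : exists lt : rel (F * F),
  [/\ irreflexive lt, transitive lt,
    forall g e e', lt (translate g e) (translate g e') = lt e e',
    forall e e', e.2 \in X -> e'.2 \in X -> e <> e' -> lt e e' || lt e' e
    & forall e e', lt e e' -> (index e.2 X <= index e'.2 X)%N].
Proof.
have [lt0 [irr tr inv tot]] := free_group_left_order hX.
exists (fun e e' => (index e.2 X < index e'.2 X)%N ||
  (index e.2 X == index e'.2 X) && lt0 e.1 e'.1); split.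
- by move=> e; rewrite ltnn irr andbF.
- move=> e2 e1 e3 /orP[h|/andP[/eqP-> h]] /orP[h'|/andP[/eqP <- h']].
  + by rewrite (ltn_trans h h').
  + by rewrite h.
  + by rewrite h'.
  + by rewrite eqxx (tr _ _ _ h h') orbT.
- by move=> g e e'; rewrite /= inv.
- move=> [f x] [g y] /= Xx Xy ne; case: ltngtP => //= /index_inj xy.
  by apply: tot => fg; apply: ne; rewrite fg xy.
- by move=> e e' /orP[/ltnW//|/andP[/eqP-> _]].
Qed.

(** As the order compares letters first, the letter of the largest edge bounds all letters of the
    word. Were its index below [i], then [h] would lie in the previous term of the flag. *)
Lemma exists_leading_edge (lt : rel (F * F)) h i :
  irreflexive lt -> transitive lt ->
  (forall e e', e.2 \in X -> e'.2 \in X -> e <> e' -> lt e e' || lt e' e) ->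
  (forall e e', lt e e' -> (index e.2 X <= index e'.2 X)%N) ->
  has_level h i ->
  exists w e b, let Q e' := e' \in path_edges 1 w /\ lt e' e in
    [/\ word_over [set` X] w, e \in path_edges 1 w, index e.2 X = i,
      reach Q 1 (endpoint e b) & reach Q (endpoint e (~~ b)) h].
Proof.
move=> irr tr tot mono [ltiX hi ni].
have [w0 w0i w0h] := (generatedP _ _).1 hi; pose w := reduce w0.
have wi : word_over [set` take i.+1 X] w by apply: word_over_reduce.
have wh : word_val w = h by rewrite word_val_reduce.
have wX : word_over [set` X] w by apply: word_over_sub wi => x /=; apply: mem_take.
have nz : w != [::].
  apply/eqP => w_nil; apply: ni; rewrite -wh w_nil word_val_nil.
  exact: subgroup1 (@generated_subgroup _ _).
have [e [b [ew emax r1 r2]]] := leading_edge hX irr tr tot wX (reduced_reduce _) nz.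
exists w, e, b; split=> //; last by rewrite -[h in reach _ _ h]wh.
apply/eqP; rewrite eqn_leq; apply/andP; split.
  have := path_edges_letter wi ew; rewrite /= in_take_leq ?ltnS //.
rewrite leqNgt; apply/negP => lt_i; apply: ni; apply/generatedP; exists w => // l lw.
rewrite /= (in_take_leq _ (ltnW ltiX)); apply: leq_ltn_trans lt_i.
have [w1 [w2 w12]] : exists w1 w2, w = w1 ++ l :: w2.
  by case/splitPr: lw => w1 w2; exists w1, w2.
pose e' := edge_at (1 * word_val w1) l.
have e'w : e' \in path_edges 1 w by rewrite w12 path_edges_cat mem_cat /= mem_head orbT.
have [<-|/eqP ne] := eqVneq e' e; first exact: leqnn.
exact: mono (emax _ e'w ne).
Qed.

Variables (Y : seq F) (H : set F).
Hypothesis HY : H = generated [set` Y].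
Hypothesis Y_level : {in Y, forall h, exists i, has_level h i}.
Hypothesis Y_inj : {in Y &, forall h h', forall i,
  has_level h i -> has_level h' i -> h = h'}.

Let hH : subgroup H.
Proof. by rewrite HY; apply: generated_subgroup. Qed.

(** The finite graph [E] is the union, modulo the intersection, of the paths of words over [Y] for
    the elements of [bs]. *)
Theorem size_intersection_basis_le G B (gs bs : seq F) :
  G = generated [set` gs] -> free_basis (H `&` G) B ->
  uniq bs -> [set` bs] `<=` B -> (size bs <= size gs)%N.
Proof.
move=> Ggs hB ubs bsB.
have hG : subgroup G by rewrite Ggs; apply: generated_subgroup.
have hK := subgroupI hH hG.
have [lt [irr tr inv tot mono]] := exists_edge_order.
pose good h (D : seq (F * bool) * (F * F) * bool) :=
  let: (w, e, b) := D in let Q e' := e' \in path_edges 1 w /\ lt e' e in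
  [/\ word_over [set` X] w, e \in path_edges 1 w, has_level h (index e.2 X),
    reach Q 1 (endpoint e b) & reach Q (endpoint e (~~ b)) h].
have /choice[D hD] : forall h, exists D, h \in Y -> good h D.
  move=> h; have [hY|_] := boolP (h \in Y); last by exists ([::], (1, 1), true).
  have [i hi] := Y_level hY.
  have [w [e [b [? ? ei ? ?]]]] := exists_leading_edge irr tr tot mono hi.
  by exists (w, e, b) => _; split=> //; rewrite ei.
pose pe h := path_edges 1 (D h).1.1; pose ld h := (D h).1.2; pose bd h := (D h).2.
pose repG := rep X X G; pose repK := rep X X (H `&` G).
have repK_in := rep_coset X hX hK : forall f, (H `&` G) (repK f / f).
have repK_eq := eq_rep X hX hK : forall f g, (H `&` G) (f / g) -> repK f = repK g.
have /choice[wd hwd] : forall b, exists w, b \in bs ->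
    word_over [set` Y] w /\ word_val w = b.
  move=> b; have [bbs|_] := boolP (b \in bs); last by exists [::].
  have : (H `&` G) b by case: hB => <- _; exact: (sub_generated (bsB _ bbs)).
  by case; rewrite HY => /generatedP[w ? ?] _; exists w.
pose E := undup [seq quotient_edge repK e | b <- bs, e <- path_edges 1 (wd b)].
have in_E b e : b \in bs -> e \in path_edges 1 (wd b) -> lifted repK E e.
  move=> bbs ew; rewrite /lifted mem_undup; apply/allpairsPdep.
  by exists b, e; split.
have E_in q : q \in E -> exists b e,
    [/\ b \in bs, e \in path_edges 1 (wd b) & q = quotient_edge repK e].
  by rewrite mem_undup => /allpairsPdep.
have E_path b e c : b \in bs -> e \in path_edges 1 (wd b) ->
    reach (lifted repK E) 1 (endpoint e c).
  move=> bbs ew; apply: reach_sub (reach_path_endpoint c ew) => e'; exact: in_E.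
apply: (@rank_comparison _ X Y H G hX hG HY repG repK _ _ _ repK_in repK_eq _
  lt irr tr inv tot pe ld bd _ _ _ _ _ _ E _ _ _ _ _ B bs gs hB ubs bsB Ggs).
- exact: rep_coset hX hG.
- exact: eq_rep hX hG.
- exact: rep1 hX hG.
- exact: rep1 hX hK.
- by move=> h /hD; rewrite /good /ld /pe; case: (D h) => [[w e] b] [].
- move=> h e /hD; rewrite /good /pe; case: (D h) => [[w e0] b] [wX _ _ _ _] /=.
  exact: path_edges_letter wX.
- by move=> h e b _; apply: reach_path_endpoint.
- by move=> h /hD; rewrite /good /ld /pe /bd; case: (D h) => [[w e] b] [].
- by move=> h /hD; rewrite /good /ld /pe /bd; case: (D h) => [[w e] b] [].
- move=> h h' hY h'Y; have := hD _ hY; have := hD _ h'Y; rewrite /good /ld.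
  case: (D h) (D h') => [[w e] b] [[w' e'] b'] [_ _ l' _ _] [_ _ l _ _] /= ee'.
  by apply: (Y_inj hY h'Y l); rewrite ee'.
- exact: undup_uniq.
- move=> q /E_in[b [e [_ _ ->]]].
  by rewrite /quotient_edge /= (rep_rep repK_in repK_eq).
- move=> q /E_in[b [e [bbs ew ->]]] /=; have [Yw _] := hwd _ bbs.
  exact: path_edges_letter Yw ew.
- move=> q /E_in[b [e [bbs ew ->]]] /=; have [Yw _] := hwd _ bbs.
  have He : H e.1.
    have [w1 [l [w2 [w12 ->]]]] := path_edges_split ew.
    have Hw : word_over H (wd b).
      by apply: word_over_sub Yw => y; rewrite HY; apply: sub_generated.
    move: Hw; rewrite w12 => /word_over_cat[Hw1 /word_over_cons[Hl _]] /=.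
    have Hv : H (1 * word_val w1) by rewrite mul1g; apply: subgroup_word.
    by case: l.2 => //; apply: subgroupM => //; apply: subgroup_letter.
  by rewrite -(mulgVK e.1 (repK e.1)); apply: subgroupM => //; case: (repK_in e.1).
- move=> q /E_in[b [e [bbs ew ->]]]; exists e => //.
  exact: (E_path b e false).
- move=> b bbs; have [_ vb] := hwd _ bbs.
  rewrite -[X in reach _ _ X]vb -[X in reach _ _ X]mul1g.
  by apply: reach_path => e; apply: in_E.
move=> v /mem_vertices_of[->|[q [c [/E_in[b [e [bbs ew ->]]] ->]]]].
  by exists 1; [exact: rep1 hX hK|apply: reach_refl].
exists (endpoint e c); last exact: E_path ew.
by rewrite (rep_endpoint repK_in repK_eq).
Qed.

End EchelonGenerators.

(** * Ranks and the echelon condition *)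

(** Turns a uniform bound on finite subsets into finiteness, since an infinite set has a subset of
    size [m.+1]. *)
Lemma bounded_finite_set (T : choiceType) (A : set T) m :
  (forall s : seq T, uniq s -> [set` s] `<=` A -> (size s <= m)%N) ->
  exists s : seq T, [/\ uniq s, A = [set` s] & (size s <= m)%N].
Proof.
move=> h; have [/finite_seqP[s As]|inf] := pselect (finite_set A); last first.
  have [B BA] := infinite_set_fset m.+1 inf.
  by rewrite ltnNge h // finmap.fset_uniq.
have As' : A = [set` undup s].
  by rewrite As; apply/seteqP; split=> x /=; rewrite mem_undup.
exists (undup s); split=> //; first exact: undup_uniq.
by apply: h; rewrite ?undup_uniq // -As'.
Qed.

Lemma card_le_seq (T U : choiceType) (A : set T) (B : set U) (t : seq U) :
  B `<=` [set` t] -> (A #<= B)%card ->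
  exists s : seq T, [/\ uniq s, A = [set` s] & (size s <= size t)%N].
Proof.
move=> Bt /ocard_geP/unsquash g; apply: bounded_finite_set => s us sA.
rewrite -(size_map some) -(size_map g t); apply: uniq_leq_size.
  by rewrite map_inj_uniq // => x y [].
move=> _ /mapP[x xs ->]; have [u Bu <-] := 'surj_g (ex_intro2 _ _ x (sA _ xs) erefl).
by apply: map_f; apply: Bt.
Qed.

Lemma seq_card_le (T U : eqType) (s : seq T) (t : seq U) :
  uniq t -> (size s <= size t)%N -> ([set` s] #<= [set` t])%card.
Proof.
case: s => [|x0 s0] ut st.
  by have -> : [set` [::]] = set0 :> set T by apply/seteqP; split.
set s := x0 :: s0 in st *.
apply: (@card_le_trans _ _ _ ((fun y => nth x0 s (index y t)) @` [set` t])).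
  apply: subset_card_le => x /= xs.
  have lt : (index x s < size t)%N by apply: leq_trans st; rewrite index_mem.
  case: t ut st lt => // y0 t0 ut st lt.
  exists (nth y0 (y0 :: t0) (index x s)); first exact: mem_nth.
  by rewrite index_uniq // nth_index.
exact: card_image_le.
Qed.

Lemma free_group_countable (F : groupType) (X : seq F) :
  free_basis [set: F] [set` X] -> countable [set: F].
Proof.
move=> [gX _]; pose val (w : seq (nat * bool)) : F :=
  word_val [seq (nth 1 X l.1, l.2) | l <- w].
apply: (@sub_countable _ _ _ [set: seq (nat * bool)]); last exact: countableP.
apply: card_le_trans (card_image_le val _); apply: subset_card_le => f _.
have : [set: F] f by []; rewrite -gX => /generatedP[w Xw <-].
exists [seq (index l.1 X, l.2) | l <- w] => //.
rewrite /val -map_comp map_id_in // => -[x b] /Xw /= xX.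
by rewrite nth_index.
Qed.

Section Ranks.
Variables (F : groupType) (X : seq F).
Hypothesis hX : free_basis [set: F] [set` X].
Implicit Types H G : set F.

Lemma rk_free_basis H : subgroup H -> free_basis H (rk H).
Proof.
move=> hH; have [B [_ [_ hB _]]] :=
  relative_nielsen_schreier (X' := X) hX (fun _ h => h) hH.
by apply: (@xgetPex _ _ [set B | free_basis H B]); exists B.
Qed.

Lemma rk_size_le H (s : seq F) : H = generated [set` s] ->
  exists t : seq F, [/\ uniq t, rk H = [set` t] & (size t <= size s)%N].
Proof.
move=> Hs; have hB : free_basis H (rk H).
  by apply: rk_free_basis; rewrite Hs; apply: generated_subgroup.
by apply: bounded_finite_set => t; apply: free_basis_size_le hB Hs.
Qed.

Lemma generated_setU1 (S T : set F) (a : F) : generated S = generated T ->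
  generated (S `|` [set a]) = generated (T `|` [set a]).
Proof.
have sub S' T' : generated S' = generated T' ->
    generated (S' `|` [set a]) `<=` generated (T' `|` [set a]).
  move=> e; apply: generated_sub; first exact: generated_subgroup.
  move=> x [S'x|->]; last by apply: sub_generated; right.
  have : generated T' x by rewrite -e; apply: sub_generated.
  by apply: generatedS => y; left.
by move=> e; apply/seteqP; split; apply: sub.
Qed.

(** A basis [U] of the smaller intersection extends to a basis [B] of the larger one, and the rank
    condition leaves room for at most one more element. If that element is outside the smaller flag
    term it has level [i]; [U] can be traded for the generators [s] already found. *)
Lemma echelon_step H i (s : seq F) : subgroup H -> (i < size X)%N ->
  H `&` generated [set` take i X] = generated [set` s] ->
  (rk (H `&` generated [set` take i.+1 X]) #<=
    card_succ (rk (H `&` generated [set` take i X])))%card ->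
  H `&` generated [set` take i.+1 X] = generated [set` s] \/
  exists2 a, has_level X a i &
    H `&` generated [set` take i.+1 X] = generated [set` a :: s].
Proof.
move=> hH iX; set A' := H `&` generated [set` take i X].
set A := H `&` generated [set` take i.+1 X] => A's rkA.
have hA : subgroup A := subgroupI hH (@generated_subgroup _ _).
have AA' : A `&` generated [set` take i X] = A'.
  apply/seteqP; split=> [x [[Hx _] ix]|x [Hx ix]]; first by split.
  by split=> //; split=> //; apply: take_generatedS ix.
have [|B [U [UB hB]]] := relative_nielsen_schreier (X' := take i X) hX _ hA.
  by move=> x; apply: mem_take.
rewrite AA' => hU.
have [t [ut rkt ts]] := rk_size_le A's.
have hA' : subgroup A' := subgroupI hH (@generated_subgroup _ _).
have gt : A' = generated [set` t] by have [<- _] := rk_free_basis hA'; rewrite rkt.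
have [u [uu Uu ut_le]] : exists u : seq F, [/\ uniq u, U = [set` u] & (size u <= size t)%N].
  by apply: bounded_finite_set => u; apply: free_basis_size_le hU gt.
have gu : A' = generated [set` u] by case: hU => <- _; rewrite Uu.
have tu_le : (size t <= size u)%N.
  by apply: (free_basis_size_le (rk_free_basis hA') gu ut); rewrite rkt.
have [r [ur rkr rt]] : exists r : seq F,
    [/\ uniq r, rk A = [set` r] & (size r <= (size t).+1)%N].
  (* The successor cardinal, listed as a sequence of length [(size t).+1]. *)
  have := card_le_seq (t := None :: map some t) _ rkA.
  rewrite /= size_map; apply; rewrite rkt => x [->|[y yt <-]] /=; first by rewrite mem_head.
  by rewrite inE /= map_f.
have gr : A = generated [set` r] by have [<- _] := rk_free_basis hA; rewrite rkr.
have gA : A = generated B by case: hB.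
have [[a Ba]|sub] := pselect (exists2 a, B a & ~ generated [set` take i X] a); last first.
  left; rewrite -A's; apply/seteqP; split; last first.
    by move=> x [Hx ix]; split=> //; apply: take_generatedS ix.
  rewrite gA; apply: generated_sub => // x Bx.
  have [Hx _] : A x by rewrite gA; apply: sub_generated.
  by split=> //; apply: contrapT => nx; apply: sub; exists x.
move=> na; right; exists a.
  split=> //; have : A a by rewrite gA; apply: sub_generated.
  by case.
have Ua : ~ U a.
  move=> Ua; apply: na; have : A' a by case: hU => <- _; apply: sub_generated.
  by case.
have BU : B = U `|` [set a].
  apply/seteqP; split=> [b Bb|b [/UB//|->//]].
  apply: contrapT => nb; have : (size (a :: b :: u) <= size r)%N.
    apply: (free_basis_size_le hB gr).
      rewrite /= uu andbT inE negb_or -andbA; apply/and3P; split.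
      - by apply/eqP => ab; apply: nb; right.
      - by apply/negP => au; apply: Ua; rewrite Uu.
      - by apply/negP => bu; apply: nb; left; rewrite Uu.
    move=> x /=; rewrite !inE => /or3P[/eqP->|/eqP->|xu] //.
    by apply: UB; rewrite Uu.
  by rewrite leqNgt /= ltnS (leq_trans rt).
have -> : [set` a :: s] = [set` s] `|` [set a].
  apply/seteqP; split=> x /=; first by rewrite inE => /orP[/eqP->|]; [right|left].
  by case=> [xs|->]; rewrite inE ?xs ?eqxx ?orbT.
by rewrite gA BU; apply: generated_setU1; rewrite Uu -gu A's.
Qed.

(** Each step adds at most one generator, of level exactly [i], while the earlier ones have smaller
    levels; so levels never repeat. *)
Lemma echelon_generators H i : subgroup H -> (i <= size X)%N ->
  (forall j, (j < i)%N -> (rk (H `&` generated [set` take j.+1 X]) #<=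
    card_succ (rk (H `&` generated [set` take j X])))%card) ->
  exists Y : seq F, [/\ H `&` generated [set` take i X] = generated [set` Y],
    {in Y, forall h, exists2 j, (j < i)%N & has_level X h j}
    & {in Y &, forall h h', forall j,
        has_level X h j -> has_level X h' j -> h = h'}].
Proof.
move=> hH; elim: i => [|i IH] iX hrk.
  exists [::]; split=> //; rewrite take0; apply/seteqP; split=> [x []//|].
  apply: generated_sub => //; apply: subgroupI => //; exact: generated_subgroup.
have [||Y [HY Ylev Yinj]] := IH; first exact: ltnW.
  by move=> j ji; apply: hrk; apply: leqW.
have [->|[a la ->]] := echelon_step hH iX HY (hrk i (leqnn _)).
  by exists Y; split=> // h /Ylev[j ji lj]; exists j => //; apply: leqW.
exists (a :: Y); split=> //.
  move=> h; rewrite inE => /orP[/eqP->|/Ylev[j ji lj]]; first by exists i.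
  by exists j => //; apply: leqW.
have new h : h \in Y -> ~ has_level X h i.
  by move=> /Ylev[j ji lj] /(has_level_inj lj) ij; rewrite ij ltnn in ji.
move=> h h'; rewrite !inE => /orP[/eqP->|hY] /orP[/eqP->|h'Y] j lj lj' //.
- by case: (new _ h'Y); rewrite (has_level_inj la lj).
- by case: (new _ hY); rewrite (has_level_inj la lj').
- exact: Yinj lj lj'.
Qed.

End Ranks.

Theorem theorem3p2 (n : nat) (F : groupType) (hF : free_of_rank F n)
  (H : set F) (hH : echelon_subgroup n H) : inert H.
Proof.
case: hH => hH [x [[ux hX] ech]] G hG.
have [sX fX] : size x = n /\ free_basis [set: F] [set` (x : seq F)].
  by rewrite size_tuple.
have [Y [HY Ylev Yinj]] : exists Y : seq F,
    [/\ H `&` generated [set` take n x] = generated [set` Y],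
    {in Y, forall h, exists2 j, (j < n)%N & has_level x h j}
    & {in Y &, forall h h', forall j, has_level x h j -> has_level x h' j -> h = h'}].
  apply: (echelon_generators fX hH); first by rewrite sX.
  (* Levels count from 0, the echelon condition from 1. *)
  by move=> j jn; apply: (ech j.+1); rewrite jn.
have {}HY : H = generated [set` Y].
  by rewrite -HY -{1}sX take_size; case: fX => -> _; rewrite setIT.
have hB := rk_free_basis fX (subgroupI hH hG).
(* An infinite rank of [G] is at least countable and so bounds every subset of the countable group
   [F]. *)
have [fin|inf] := pselect (finite_set (rk G)); last first.
  apply: card_le_trans (card_leT _) _.
  by apply: card_le_trans (free_group_countable fX) _; apply/infiniteP.
have [s us Gs] : exists2 s : seq F, uniq s & rk G = [set` s].
  case/finite_seqP: fin => s ->; exists (undup s); first exact: undup_uniq.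
  by apply/seteqP; split=> y /=; rewrite mem_undup.
have gs : G = generated [set` s] by have [<- _] := rk_free_basis fX hG; rewrite Gs.
have [t [ut Kt ts]] : exists t : seq F,
    [/\ uniq t, rk (H `&` G) = [set` t] & (size t <= size s)%N].
  apply: bounded_finite_set => t; apply: (size_intersection_basis_le fX HY _ Yinj gs hB).
  by move=> h /Ylev[j _ lj]; exists j.
by rewrite Kt Gs; apply: seq_card_le.
Qed.
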